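(* Let $X$ be a quasi-reflexive Banach space. If the Szlenk index of $X$ satisfies $S_Z(X)\leq\omega$ and the Szlenk index of its dual space satisfies $S_Z(X^* )\leq \omega$, then the family $(T_N)_{N\geq 1}$ of countably branching trees (each equipped with its hyperbolic distance) does not equi-Lipschitz embed into $X$.
   Context: Quasi-reflexive: a Banach space $X$ is quasi-reflexive if the quotient $X^{**}/X$ is finite dimensional. Countably branching trees: for $N\geq 1$, $T_N=\{\emptyset\}\cup\bigcup_{n=1}^N\mathbb{N}^n$ is the set of sequences of integers of length at most $N$. For $s\in T_N$, $|s|$ is the length of $s$ (with $|\emptyset|=0$), and for $s,t\in T_N$, $a_{s,t}$ is their greatest common ancestor, i.e. their longest common initial segment. The hyperbolic distance on $T_N$ is $d(s,t)=|s|+|t|-2|a_{s,t}|$; it is the graph distance of the graph obtained by putting an edge between each non-empty sequence and the sequence obtained by deleting its last term. Equi-Lipschitz embedding: a family of metric spaces $(M_i,d_i)_{i\in I}$ equi-Lipschitz embeds into a metric space $(N,\delta)$ if there are maps $f_i:M_i\to N$ $(i\in I)$ and constants $a,b>0$ (independent of $i$) such that $a\,d_i(x,y)\leq \delta(f_i(x),f_i(y))\leq b\,d_i(x,y)$ for all $i\in I$ and all $x,y\in M_i$. Szlenk index: let $X$ be a Banach space, $K$ a weak$^*$-compact subset of $X^*$ and $\varepsilon>0$. Let $\mathcal{V}$ be the set of all (relatively) weak$^*$-open subsets $V$ of $K$ with norm-diameter $\operatorname{diam} V\leq\varepsilon$, and let $s_\varepsilon(K)=K\setminus\bigcup_{V\in\mathcal{V}}V$.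 Define inductively $s^1_\varepsilon(K)=s_\varepsilon(K)$, $s_\varepsilon^{\alpha+1}(K)=s_\varepsilon(s_\varepsilon^\alpha(K))$ for ordinals $\alpha\geq 1$, and $s_\varepsilon^\alpha(K)=\bigcap_{\beta<\alpha}s_\varepsilon^\beta(K)$ if $\alpha$ is a limit ordinal. Let $S_Z(K,\varepsilon)=\inf\{\alpha:\ s_\varepsilon^\alpha(K)=\emptyset\}$ if such an $\alpha$ exists and $S_Z(K,\varepsilon)=\infty$ otherwise (where $\infty$ is larger than every ordinal). Let $S_Z(K)=\sup_{\varepsilon>0}S_Z(K,\varepsilon)$ and $S_Z(X)=S_Z(B_{X^*})$, where $B_{X^*}$ is the closed unit ball of $X^*$. Here $\omega$ denotes the first infinite ordinal. *)

(* Defs.v *)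
From HB Require Import structures.
From mathcomp Require Import all_boot all_order all_algebra.
From mathcomp Require Import generic_quotient ring_quotient.
From mathcomp Require Import all_classical all_reals all_analysis.

Set Implicit Arguments.
Unset Strict Implicit.
Unset Printing Implicit Defensive.

Import Order.TTheory GRing.Theory Num.Theory.
Import numFieldNormedType.Exports.

Local Open Scope classical_set_scope.
Local Open Scope ring_scope.

Section Dual.
Variables (R : realType) (X : normedModType R).

Definition is_functional : {pred X -> R^o} :=
  [pred f | `[< linear f /\ continuous f >]].

Lemma is_functionalP (f : X -> R^o) :
  reflect (linear f /\ continuous f) (f \in is_functional).
Proof. exact: asboolP. Qed.

Lemma is_functional_closed : submod_closed is_functional.
Proof.
split=> [|a f g /is_functionalP[lf cf] /is_functionalP[lg cg]].
  apply/is_functionalP; split=> [a x y|]; last exact: cst_continuous.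
  by rewrite /= scaler0 addr0.
apply/is_functionalP; split=> [b x y|x].
  rewrite /= !fctE lf lg !scalerDr !scalerA (mulrC a b) -!addrA.
  by congr (_ + _); rewrite addrCA.
by apply: continuousD; [apply: continuousZl_tmp; exact: cf|exact: cg].
Qed.
HB.instance Definition _ :=
  GRing.isSubmodClosed.Build R (X -> R^o) is_functional is_functional_closed.

Record dual : Type := Dual {
  dual_fun :> X -> R^o;
  dual_funP : dual_fun \in is_functional }.

HB.instance Definition _ := [isSub for dual_fun].
HB.instance Definition _ := [Choice of dual by <:].
HB.instance Definition _ := [SubChoice_isSubLmodule of dual by <:].

Implicit Types (f g : dual) (x : X).

Lemma dual_linear f : linear f.
Proof. by case: f => f /= /is_functionalP[]. Qed.
HB.instance Definition _ f := GRing.isLinear.Build R X R^o _ f (dual_linear f).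

Lemma dual_continuous f : continuous f.
Proof. by case: f => f /= /is_functionalP[]. Qed.

Lemma dualP f g : (forall x, f x = g x) -> f = g.
Proof. by move=> fg; apply/val_inj/funext. Qed.

Definition dual_norm f : R := sup [set `|f x| | x in [set x : X | `|x| <= 1]].

Lemma dual_has_sup f : has_sup [set `|f x| | x in [set x : X | `|x| <= 1]].
Proof.
split; first by exists `|f 0|, 0 => //=; rewrite normr0.
have /linear_bounded_continuous/bounded_funP/(_ 1)[M fM] := @dual_continuous f.
by exists M => _ [x /= x1 <-]; exact: fM.
Qed.

Lemma ler_dual_norm f x : `|f x| <= dual_norm f * `|x|.
Proof.
have [->|x0] := eqVneq x 0; first by rewrite linear0 !normr0 mulr0.
have nx : 0 < `|x| by rewrite normr_gt0.
rewrite -ler_pdivrMr// mulrC.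
have -> : `|x|^-1 * `|f x| = `|f (`|x|^-1 *: x)|.
  by rewrite linearZ/= normrZ normfV normr_id.
apply: (sup_upper_bound (dual_has_sup f)).
exists (`|x|^-1 *: x) => //=.
by rewrite normrZ normfV normr_id mulVf// gt_eqF.
Qed.

Lemma dual_norm_le f (M : R) :
  (forall x, `|x| <= 1 -> `|f x| <= M) -> dual_norm f <= M.
Proof.
move=> fM; apply: ge_sup; first by case: (dual_has_sup f).
by move=> _ [x /= x1 <-]; exact: fM.
Qed.

Lemma dual_norm_ge0 f : 0 <= dual_norm f.
Proof.
apply: le_trans (sup_upper_bound (dual_has_sup f) _).
  exact: (normr_ge0 (f 0)).
by exists 0 => //=; rewrite normr0.
Qed.

Lemma ler_dual_normD f g : dual_norm (f + g) <= dual_norm f + dual_norm g.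
Proof.
apply: dual_norm_le => x x1; apply: le_trans (ler_normD _ _) _.
by apply: lerD; apply: le_trans (ler_dual_norm _ _) _;
  rewrite ler_piMr ?dual_norm_ge0.
Qed.

Lemma dual_normZ (a : R) f : dual_norm (a *: f) = `|a| * dual_norm f.
Proof.
have le b h : dual_norm (b *: h) <= `|b| * dual_norm h.
  apply: dual_norm_le => x x1; rewrite [X in `|X|]/(b * h x) normrM.
  rewrite ler_wpM2l//; apply: le_trans (ler_dual_norm _ _) _.
  by rewrite ler_piMr ?dual_norm_ge0.
apply/eqP; rewrite eq_le le /=.
have [->|a0] := eqVneq a 0; first by rewrite normr0 mul0r dual_norm_ge0.
rewrite -{1}[f](scalerK a0) -ler_pdivlMl ?normr_gt0//.
by rewrite -normfV le.
Qed.

Lemma dual_norm0_eq0 f : dual_norm f = 0 -> f = 0.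
Proof.
move=> f0; apply: dualP => x; apply/eqP; rewrite -normr_le0.
by apply: le_trans (ler_dual_norm _ _) _; rewrite f0 mul0r.
Qed.

HB.instance Definition _ :=
  Lmodule_isNormed.Build R dual ler_dual_normD dual_normZ dual_norm0_eq0.

End Dual.

Definition weak_star (R : realType) (X : normedModType R) : Type :=
  initial_topology (fun f : dual X => (f : X -> R^o) : {ptws X -> R^o}).
HB.instance Definition _ (R : realType) (X : normedModType R) :=
  Topological.on (weak_star X).

Section Quotient.
Variables (R : pzRingType) (E : lmodType R) (W : {pred E}).

Definition submod_pred of submod_closed W : {pred E} := W.
HB.instance Definition _ (W_closed : submod_closed W) :=
  GRing.isSubmodClosed.Build R E (submod_pred W_closed) W_closed.

Variable W_closed : submod_closed W.

Definition lquot : Type := Quotient.quot (submod_pred W_closed).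
HB.instance Definition _ := GRing.Zmodule.on lquot.

Definition lpi (u : E) : lquot := \pi_(Quotient.quot (submod_pred W_closed))%qT u.
Definition lrepr (q : lquot) : E :=
  repr (q : Quotient.quot (submod_pred W_closed)).

Definition lquot_scale (a : R) (q : lquot) : lquot := lpi (a *: lrepr q).

Lemma lpiD (u v : E) : lpi (u + v) = lpi u + lpi v.
Proof. exact: (@Quotient.pi_add _ (submod_pred W_closed) u v). Qed.

Lemma lpi_eqP (u v : E) : reflect (lpi u = lpi v) (u - v \in W).
Proof.
rewrite -[u - v \in W]/(u - v \in submod_pred W_closed) Quotient.idealrBE.
exact: eqP.
Qed.

Lemma lreprK (q : lquot) : lpi (lrepr q) = q.
Proof. exact: reprK. Qed.

Lemma lpiZ a (u : E) : lpi (a *: u) = lquot_scale a (lpi u).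
Proof.
apply/lpi_eqP; rewrite -scalerBr.
have /lpi_eqP : lpi u = lpi (lrepr (lpi u)) by rewrite lreprK.
exact: (@rpredZ _ _ (submod_pred W_closed)).
Qed.

Fact lquot_scaleA a b (q : lquot) :
  lquot_scale a (lquot_scale b q) = lquot_scale (a * b) q.
Proof. by rewrite -[q]lreprK -!lpiZ scalerA. Qed.

Fact lquot_scale1 : left_id 1 lquot_scale.
Proof. by move=> q; rewrite -[q]lreprK -lpiZ scale1r. Qed.

Fact lquot_scaleDr : right_distributive lquot_scale +%R.
Proof.
by move=> a q r; rewrite -[q]lreprK -[r]lreprK -lpiD -!lpiZ scalerDr lpiD.
Qed.

Fact lquot_scaleDl (q : lquot) : {morph lquot_scale^~ q : a b / a + b}.
Proof. by move=> a b; rewrite -[q]lreprK -!lpiZ scalerDl lpiD. Qed.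

HB.instance Definition _ := GRing.Zmodule_isLmodule.Build R lquot
  lquot_scaleA lquot_scale1 lquot_scaleDr lquot_scaleDl.

End Quotient.

Definition finite_dimensional (R : pzRingType) (E : lmodType R) : Prop :=
  exists (n : nat) (e : 'I_n -> E),
    forall v : E, exists c : 'I_n -> R, v = \sum_(i < n) c i *: e i.

Section QuasiReflexive.
Variables (R : realType) (X : normedModType R).

Lemma bidual_functional (x : X) :
  (fun f : dual X => f x) \in @is_functional R (dual X).
Proof.
apply/is_functionalP; split=> [//|].
pose ev : dual X -> R^o := fun f => f x.
have ev_lin : linear ev by [].
pose evL := GRing.isLinear.Build R (dual X) R^o _ ev ev_lin.
pose L : {linear dual X -> R^o} := HB.pack ev evL.
apply: (@bounded_linear_continuous _ _ _ L); apply/bounded_funP => r.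
exists (r * `|x|) => f fr.
by apply: le_trans (ler_dual_norm f x) _; rewrite ler_wpM2r.
Qed.

Definition bidual_emb (x : X) : dual (dual X) := Dual (bidual_functional x).

Definition bidual_range : {pred dual (dual X)} :=
  [pred phi | `[< exists x, phi = bidual_emb x >]].

Lemma bidual_range_closed : submod_closed bidual_range.
Proof.
split=> [|a _ _ /asboolP[x ->] /asboolP[y ->]]; apply/asboolP.
  by exists 0; apply: dualP => f; rewrite /= linear0.
by exists (a *: x + y); apply: dualP => f; rewrite /= linearP.
Qed.

Definition quasi_reflexive : Prop :=
  finite_dimensional (lquot bidual_range_closed).

End QuasiReflexive.

(** Codes for ordinals; distinct codes may denote the same ordinal, equality of
    ordinals being [ole a b /\ ole b a].  [osup f] is the least upper bound of
    the family [f], which need not be increasing. *)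
Inductive ord : Type :=
| ozero
| osucc of ord
| osup (I : Type) of I -> ord.

Fixpoint ole (a b : ord) {struct a} : Prop :=
  match a with
  | ozero => True
  | osucc a' =>
      (fix gt_a' (b : ord) : Prop :=
         match b with
         | ozero => False
         | osucc b' => ole a' b'
         | osup J g => exists i, gt_a' (g i)
         end) b
  | osup J f => forall i, ole (f i) b
  end.

Lemma ole_trans b a c : ole a b -> ole b c -> ole a c.
Proof.
elim: a b c => [//|a IHa|I f IHf] b c; last first.
  by move=> fb bc i; apply: IHf (fb i) bc.
elim: b c => [//|b _|J g IHg] c; last by case=> i agi gc; exact: IHg agi (gc i).
elim: c => [//|c _|K h IHh]; first exact: IHa.
by move=> ab [k bhk]; exists k; exact: IHh.
Qed.

Lemma ole_osup a (I : Type) (f : I -> ord) i : ole a (f i) -> ole a (osup f).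
Proof.
by elim: a => [//|a _|J g IHg]; [exists i|move=> gf j; exact: IHg (gf j)].
Qed.

Lemma ole_refl a : ole a a.
Proof. by elim: a => // I f IHf i; exact: ole_osup (IHf i). Qed.

Lemma oleS a : ole a (osucc a).
Proof.
elim: a => [//|//|I f IHf i]; apply: ole_trans (IHf i) _.
exact: ole_osup (ole_refl (f i)).
Qed.

Lemma ole_total a b : ole a b \/ ole (osucc b) a.
Proof.
elim: a b => [b|a IHa b|I f IHf b]; first by left.
  elim: b => [|b _|J g IHg]; [by right|exact: IHa|].
  have [[j agj]|] := pselect (exists j, ole (osucc a) (g j)).
    by left; exists j.
  move=> /forallNP ag; right => j.
  by have [/ag//|] := IHg j.
have [[i bfi]|] := pselect (exists i, ole (osucc b) (f i)).
  by right; exists i.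
by move=> /forallNP bf; left => i; have [//|/bf] := IHf i b.
Qed.

Definition ord_least (P : ord -> Prop) (a : ord) : Prop :=
  P a /\ forall b, P b -> ole a b.

Lemma ex_ord_least (P : ord -> Prop) :
  (exists a, P a) -> exists a, ord_least P a.
Proof.
suff H a : (exists2 b, P b & ole b a) -> exists b, ord_least P b.
  by case=> a Pa; apply: (H a); exists a => //; exact: ole_refl.
elim: a => [|a IHa|I f IHf] [b Pb ba].
- by exists b; split => // c _; apply: ole_trans ba _.
- have [/IHa//|nPa] := pselect (exists2 c, P c & ole c a).
  exists b; split => // c Pc; apply: ole_trans ba _.
  by have [ca|//] := ole_total c a; case: nPa; exists c.
- have [[i /IHf//]|nPf] := pselect (exists i, exists2 c, P c & ole c (f i)).
  exists b; split => // c Pc; apply: ole_trans ba _ => i.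
  have [cf|fc] := ole_total c (f i); first by case: nPf; exists i, c.
  exact: ole_trans (oleS _) fc.
Qed.

Definition ord_nat (n : nat) : ord := iter n osucc ozero.
Definition omega : ord := osup ord_nat.

(** [None] is the value infinity, larger than every ordinal. *)
Definition eord := option ord.

Definition eole (x y : eord) : Prop :=
  match x, y with
  | _, None => True
  | None, Some _ => False
  | Some a, Some b => ole a b
  end.

Definition eord_inf (P : ord -> Prop) : eord :=
  match pselect (exists a, P a) with
  | left exP => Some (sval (cid (ex_ord_least exP)))
  | right _ => None
  end.

Definition eord_sup (I : Type) (x : I -> eord) : eord :=
  if pselect (exists i, x i = None) then None
  else Some (osup (fun i => odflt ozero (x i))).

Section Szlenk.
Variables (R : realType) (X : normedModType R).

Definition norm_diam (V : set (dual X)) : \bar R :=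
  ereal_sup [set `|p.1 - p.2|%:E | p in V `*` V].

Definition weak_star_open_in (K V : set (dual X)) : Prop :=
  exists2 U : set (weak_star X), open U & V = K `&` U.

Definition szlenk_deriv (eps : R) (K : set (dual X)) : set (dual X) :=
  K `\` \bigcup_(V in [set V | weak_star_open_in K V /\
                               (norm_diam V <= eps%:E)%E]) V.

(** The intersection with [K] in the last case only matters for the supremum
    of the empty family.  A limit ordinal is the supremum of the ordinals below
    it; for a general family this is still the right value since the derived
    sets decrease. *)
Fixpoint szlenk_iter (eps : R) (K : set (dual X)) (a : ord) : set (dual X) :=
  match a with
  | ozero => K
  | osucc a' => szlenk_deriv eps (szlenk_iter eps K a')
  | osup J f => K `&` \bigcap_i szlenk_iter eps K (f i)
  end.

Definition szlenk_eps (K : set (dual X)) (eps : R) : eord :=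
  eord_inf (fun a => szlenk_iter eps K a = set0).

Definition szlenk_set (K : set (dual X)) : eord :=
  eord_sup (fun eps : {e : R | 0 < e} => szlenk_eps K (val eps)).

Definition szlenk_index : eord := szlenk_set [set f : dual X | `|f| <= 1].

End Szlenk.

Definition tree (N : nat) : Type := {s : seq nat | (size s <= N)%N}.

Fixpoint common_prefix (s t : seq nat) : seq nat :=
  match s, t with
  | x :: s', y :: t' => if x == y then x :: common_prefix s' t' else [::]
  | _, _ => [::]
  end.

Definition tree_dist (R : realType) (N : nat) (s t : tree N) : R :=
  (size (val s))%:R + (size (val t))%:R
  - 2 * (size (common_prefix (val s) (val t)))%:R.

Definition equi_lipschitz_embeds (R : realType) (I : Type) (M : I -> Type)
    (d : forall i, M i -> M i -> R) (T : Type) (delta : T -> T -> R) : Prop :=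
  exists (f : forall i, M i -> T) (a b : R),
    [/\ 0 < a, 0 < b &
      forall i (x y : M i),
        a * d i x y <= delta (f i x) (f i y) <= b * d i x y].

(* Main.v *)
Require Import Defs.
From HB Require Import structures.
From mathcomp Require Import all_boot all_order all_algebra.
From mathcomp Require Import all_classical all_reals all_analysis.
From mathcomp Require Import lra ring.

Set Implicit Arguments.
Unset Strict Implicit.
Unset Printing Implicit Defensive.

Import Order.TTheory GRing.Theory Num.Theory.
Import numFieldNormedType.Exports.

Local Open Scope classical_set_scope.
Local Open Scope ring_scope.

(** The proof compares the increments of an embedding at different scales.  Let [f]
    embed a tree of large height.  For two branches run in parallel, let [G] be the
    difference of the values of [f] along them.  A property of nodes or branches is
    called typical when it holds for most choices of their successive terms along a
    fixed free ultrafilter.  If [r] bounds the typical increments of [G] over [h]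
    levels, then cutting into [M] blocks bounds those over [M * h] levels by
    [M * r].  This is improved to [(1 - theta) * M * r], with [theta] and [M]
    independent of [h] ([increments_contract]).  Iterating, typical increments over
    [M ^ L] levels are at most a constant times [(1 - theta) ^ L * M ^ L].  For large
    [L] this is impossible, because two branches that separate at the root move apart
    linearly.

    The gain uses both hypotheses on Szlenk indices; by a compactness argument each
    says that, for every [eps], finitely many derivations exhaust the dual ball
    ([szlenk_index_omega_finite]).

    For the dual of [X] this yields a renorming.  Consider the norm of an element of
    the dual of [X] after [k] successive weakly null perturbations of size [tau].
    Each perturbation either raises it by at most [tau * eps] or forces the point of
    the bidual ball where it is attained one derived set deeper ([upper_norm_szlenk]).
    The average of these norms over [k] is therefore asymptotically smooth at scale
    [tau] ([mean_norm_perturb]).  Dually the bidual has an equivalent norm for which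
    the weak star limit of separated points of the unit ball has norm at most
    [1 - delta] ([ex_asymptotically_convex]).

    For [X] itself it says that the functionals norming increments over [M] blocks,
    and their weak star limits along the tree, have a small jump at some level
    ([ex_small_jump]).  If long increments were nearly [M * r], then every block would
    be nearly extremal ([block_extremal]), and the limit functional at a node of that
    level would be nearly extremal on all typical increments from this node at once.
    These increments are separated, since two of them may share the second branch
    ([paired_increments_apart]), so their weak star limit contradicts asymptotic
    convexity.

    Quasi-reflexivity enters in one step.  The limit functional lies only in the weak
    star closure of the renormed ball, so that it can be approximated by elements of
    this ball on [X], not on the bidual.  But the limit [x] of the increments of [G] is
    almost in [X]: it is a difference of two limits of increments of [f] at nodes of
    one level, and modulo [X] these limits converge along typical nodes, by finite
    dimension ([paired_limit_near_space]). *)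

(** The value of a functional, typed in [R] rather than in the module [R^o]. *)
Local Notation "f @@ x" := (dual_fun f x : Real.sort _)
  (at level 12, x at level 10, only parsing).

(** * The Hahn-Banach theorem *)

Section HahnBanach.
Variables (R : realType) (E : normedModType R).

Definition sublinear (p : E -> R) : Prop :=
  (forall x y, p (x + y) <= p x + p y) /\
  (forall a x, 0 <= a -> p (a *: x) = a * p x).

Lemma sublinear_ge (p : E -> R) x : sublinear p -> - p (- x) <= p x.
Proof.
case=> pD pZ; have := pD x (- x); rewrite subrr.
by have := pZ 0 0 (lexx 0); rewrite scale0r mul0r => ->; lra.
Qed.

(** The greatest sublinear functional below [p] whose value at [- y] is [- p y]. *)
Definition directional (p : E -> R) (y x : E) : R :=
  inf [set p (x + t *: y) - t * p y | t in [set t : R | 0 <= t]].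

Lemma directional_has_inf p y x : sublinear p ->
  has_inf [set p (x + t *: y) - t * p y | t in [set t : R | 0 <= t]].
Proof.
move=> ps; split; first by exists (p (x + 0 *: y) - 0 * p y), 0 => /=.
exists (- p (- x)) => _ [t /= t0 <-].
have := ps.1 (x + t *: y) (- x); rewrite addrAC subrr add0r ps.2 //; lra.
Qed.

Lemma directional_le p y x t : sublinear p -> 0 <= t ->
  directional p y x <= p (x + t *: y) - t * p y.
Proof.
move=> ps t0; apply: ge_inf; last by exists t.
exact: (directional_has_inf y x ps).2.
Qed.

Lemma directional_le_base p y x : sublinear p -> directional p y x <= p x.
Proof.
move=> ps; have := directional_le y x ps (lexx 0).
by rewrite scale0r addr0 mul0r subr0.
Qed.

Lemma directional_ge p y x r : sublinear p ->
  (forall t, 0 <= t -> r <= p (x + t *: y) - t * p y) -> r <= directional p y x.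
Proof.
move=> ps H; apply: lb_le_inf; first exact: (directional_has_inf y x ps).1.
by move=> _ [t /= t0 <-]; exact: H.
Qed.

Lemma directional_sublinear p y : sublinear p -> sublinear (directional p y).
Proof.
move=> ps; split=> [x z|a x].
  rewrite -lerBlDr; apply: directional_ge => // t t0.
  rewrite lerBlDl -lerBlDr; apply: directional_ge => // s s0.
  rewrite lerBlDl; apply: le_trans (directional_le _ _ ps (addr_ge0 s0 t0)) _.
  have := ps.1 (x + t *: y) (z + s *: y).
  rewrite addrACA -scalerDl (addrC s t); lra.
rewrite le_eqVlt => /predU1P[<-|a0].
  rewrite scale0r mul0r; apply/eqP; rewrite eq_le; apply/andP; split.
    apply: le_trans (directional_le_base _ _ ps) _.
    by rewrite -(scale0r 0) ps.2// mul0r.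
  by apply: directional_ge => // t t0; rewrite add0r ps.2 ?subrr.
apply/eqP; rewrite eq_le; apply/andP; split.
  rewrite -ler_pdivrMl//; apply: directional_ge => // t t0.
  rewrite ler_pdivrMl//.
  apply: le_trans (directional_le _ _ ps (mulr_ge0 (ltW a0) t0)) _.
  by rewrite -scalerA -scalerDr (ps.2 _ _ (ltW a0)) mulrBr mulrA.
apply: directional_ge => // t t0.
have ai0 : 0 <= a^-1 by rewrite invr_ge0 ltW.
have at0 : 0 <= a^-1 * t by exact: mulr_ge0.
rewrite -ler_pdivlMl//; apply: le_trans (directional_le _ _ ps at0) _.
rewrite mulrBr mulrA -(ps.2 _ _ ai0) scalerDr !scalerA mulVf ?gt_eqF//.
by rewrite scale1r.
Qed.

Definition bounded_by_norm (p : E -> R) : Prop :=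
  sublinear p /\ forall x, p x <= `|x|.

(** Minimal sublinear functionals are linear, since [directional] cannot lower
    them; Zorn's lemma applies because the values at [x] along a chain are
    bounded below by [- `|x|]. *)
Lemma ex_minimal_sublinear (p0 : E -> R) : bounded_by_norm p0 ->
  exists p, [/\ bounded_by_norm p, forall x, p x <= p0 x &
    forall q, sublinear q -> (forall x, q x <= p x) -> q = p].
Proof.
move=> p0s.
pose S := {p : E -> R | bounded_by_norm p /\ forall x, p x <= p0 x}.
pose le (p q : S) := `[< forall x, sval q x <= sval p x >].
have slb (p : S) x : - `|x| <= sval p x.
  have [[ps pn] _] := svalP p.
  have := sublinear_ge x ps; have := pn (- x); rewrite normrN; lra.
have [| | |A Atot|p pmin] := @Zorn S le.
- by move=> p; apply/asboolP => x.
- move=> p q r /asboolP pq /asboolP qr; apply/asboolP => x.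
  exact: le_trans (qr x) (pq x).
- move=> [p pP] [q qP] /asboolP/= pq /asboolP/= qp; apply: eq_exist => /=.
  by apply: funext => x; apply/eqP; rewrite eq_le (pq x) (qp x).
- have [A0|/forallNP A0] := pselect (exists p, A p); last first.
    by exists (exist _ p0 (conj p0s (fun x => lexx (p0 x)))) => s /A0.
  pose V x := [set sval p x | p in A].
  have Vlb x : has_lbound (V x).
    by exists (- `|x|) => _ [p _ <-]; exact: slb.
  have Vi x : V x !=set0 by case: A0 => p Ap; exists (sval p x), p.
  pose m x := inf (V x).
  have mle p x : A p -> m x <= sval p x.
    by move=> Ap; apply: ge_inf => //; exists p.
  have mge x r : (forall p, A p -> r <= sval p x) -> r <= m x.
    by move=> H; apply: lb_le_inf => // _ [p Ap <-]; exact: H.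
  have ms : sublinear m.
    split=> [x y|a x a0].
      rewrite -lerBlDr; apply: (mge) => p Ap.
      rewrite lerBlDl -lerBlDr; apply: (mge) => q Aq; rewrite lerBlDl.
      have [/asboolP pq|/asboolP qp] := Atot _ _ Ap Aq.
        apply: le_trans (mle _ _ Aq) _.
        apply: le_trans ((svalP q).1.1.1 _ _) _.
        by rewrite lerD2r; exact: pq.
      apply: le_trans (mle _ _ Ap) _.
      apply: le_trans ((svalP p).1.1.1 _ _) _.
      by rewrite lerD2l; exact: qp.
    move: a0; rewrite le_eqVlt => /predU1P[<-|a0].
      have sv0 (p : S) : sval p 0 = 0.
        by have := (svalP p).1.1.2 0 0 (lexx 0); rewrite scale0r mul0r.
      rewrite scale0r mul0r; apply/eqP; rewrite eq_le; apply/andP; split.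
        by have [p Ap] := A0; rewrite -(sv0 p); exact: mle.
      by apply: (mge) => p Ap; rewrite sv0.
    apply/eqP; rewrite eq_le; apply/andP; split.
      rewrite -ler_pdivrMl//; apply: (mge) => p Ap; rewrite ler_pdivrMl//.
      by rewrite -((svalP p).1.1.2 _ _ (ltW a0)); exact: mle.
    apply: (mge) => p Ap; rewrite ((svalP p).1.1.2 _ _ (ltW a0)) ler_pM2l//.
    exact: mle.
  have mb : bounded_by_norm m /\ forall x, m x <= p0 x.
    have [p Ap] := A0; split; first split=> // x.
      by apply: le_trans (mle _ _ Ap) _; exact: (svalP p).1.2.
    by move=> x; apply: le_trans (mle _ _ Ap) _; exact: (svalP p).2.
  by exists (exist _ m mb) => p Ap; apply/asboolP => x; exact: mle.
have [[ps pn] pp0] := svalP p.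
exists (sval p); split=> // q qs qp.
have qP : bounded_by_norm q /\ forall x, q x <= p0 x.
  split; first split=> // x; last by move=> x; exact: le_trans (qp x) (pp0 x).
  exact: le_trans (qp x) (pn x).
by have /(congr1 sval) := pmin (exist _ q qP) (asboolT qp).
Qed.

Lemma minimal_sublinear_additive (p : E -> R) : sublinear p ->
  (forall q, sublinear q -> (forall x, q x <= p x) -> q = p) ->
  forall x y, p (x + y) = p x + p y.
Proof.
move=> ps pmin x y; apply/eqP; rewrite eq_le ps.1 /=.
have dp : directional p y = p.
  apply: pmin; first exact: directional_sublinear.
  by move=> z; exact: directional_le_base.
have := directional_le y x ps (@ler01 R).
by rewrite dp scale1r mul1r lerBrDr.
Qed.

(** Start from the norm lowered in the direction [x]: its value at [- x] is at
    most [- `|x|], and so is that of a linear functional below it. *)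
Lemma hahn_banach_norming (x : E) :
  exists phi : dual E, `|phi| <= 1 /\ phi x = `|x|.
Proof.
pose n (y : E) := `|y|.
have ns : sublinear n.
  by split=> [y z|a y a0]; [exact: ler_normD|rewrite /n normrZ ger0_norm].
have [|p [[ps pn] pp0 pmin]] := @ex_minimal_sublinear (directional n x).
  split; first exact: directional_sublinear.
  by move=> y; exact: directional_le_base.
have pD := minimal_sublinear_additive ps pmin.
have p0 : p 0 = 0 by have := pD 0 0; rewrite addr0; lra.
have pN y : p (- y) = - p y by have := pD y (- y); rewrite subrr p0; lra.
have pZ a y : p (a *: y) = a * p y.
  have [a0|a0] := leP 0 a; first by rewrite ps.2.
  have na0 : 0 <= - a by rewrite oppr_ge0 ltW.
  by rewrite -[a in LHS]opprK scaleNr pN ps.2// mulNr opprK.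
have pl : linear (p : E -> R^o) by move=> a y z; rewrite pD pZ.
have pabs y : `|p y| <= `|y|.
  by rewrite ler_norml pn andbT lerNl -pN -normrN pn.
pose pL : {linear E -> R^o} :=
  HB.pack (p : E -> R^o) (GRing.isLinear.Build R E R^o _ p pl).
have pc : continuous (p : E -> R^o).
  apply: (@bounded_linear_continuous _ _ _ pL); apply/bounded_funP => r.
  by exists r => y yr; exact: le_trans (pabs y) yr.
have pf : (p : E -> R^o) \in @is_functional R E by exact/is_functionalP.
exists (Dual pf); split.
  by apply: dual_norm_le => y y1; exact: le_trans (pabs y) y1.
apply/eqP; rewrite eq_le pn /= -lerN2 -pN.
apply: le_trans (pp0 _) _; apply: le_trans (directional_le _ _ ns ler01) _.
by rewrite scale1r addNr mul1r /n normr0 sub0r.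
Qed.

Lemma bidual_emb_norm (x : E) : `|bidual_emb x| = `|x|.
Proof.
apply/eqP; rewrite eq_le; apply/andP; split.
  apply: dual_norm_le => f f1; apply: le_trans (ler_dual_norm f x) _.
  by rewrite ler_piMl.
have [f [f1 fx]] := hahn_banach_norming x.
have := ler_dual_norm (bidual_emb x) f; rewrite /= fx normr_id => /le_trans.
by apply; rewrite ler_piMr// dual_norm_ge0.
Qed.
End HahnBanach.

(** * Limits along ultrafilters *)

Section Ultrafilters.

Lemma ultra_filterP (T : Type) (F : set_system T) : ProperFilter F ->
  (forall A : set T, F A \/ F (~` A)) -> UltraFilter F.
Proof.
move=> FF dich; split=> // G GF FG; rewrite eqEsubset; split=> // A GA.
have [//|/FG GnA] := dich A.
by have [x []] := filter_ex (filterI GA GnA).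
Qed.

Lemma ultra_not (T : Type) (F : set_system T) (P : T -> Prop) :
  UltraFilter F -> ~ (\forall t \near F, P t) -> \forall t \near F, ~ P t.
Proof. by move=> FU nP; have [//|] := in_ultra_setVsetC [set t | P t] FU. Qed.

Lemma ultra_exists_lt (T : Type) (F : set_system T) (M : nat)
    (P : nat -> T -> Prop) : UltraFilter F ->
  (\forall t \near F, exists2 m, (m < M)%N & P m t) ->
  exists2 m, (m < M)%N & \forall t \near F, P m t.
Proof.
move=> FU; elim: M => [|M IHM] H; first by have [t [m]] := filter_ex H.
have [FP|/(ultra_not FU) FnP] := pselect (\forall t \near F, P M t).
  by exists M.
have [m mM Pm] : exists2 m, (m < M)%N & \forall t \near F, P m t.
  apply: IHM; apply: filterS2 H FnP => t [m + Pm] nPM.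
  by rewrite ltnS leq_eqVlt => /predU1P[mM|mM]; [move: Pm; rewrite mM|exists m].
by exists m => //; exact: ltnW.
Qed.

Lemma filter_forall_lt (T : Type) (F : set_system T) (M : nat)
    (P : nat -> T -> Prop) : Filter F ->
  (forall m, (m < M)%N -> \forall t \near F, P m t) ->
  \forall t \near F, forall m, (m < M)%N -> P m t.
Proof.
move=> FF; elim: M => [|M IHM] H; first by apply: filterE => t m.
have HM := H M (ltnSn M).
have := IHM (fun m mM => H m (ltnW mM)); apply: filterS2 HM => t PM Pt m.
by rewrite ltnS leq_eqVlt => /predU1P[->|/Pt].
Qed.

Lemma fmap_ultra (T U : Type) (F : set_system T) (f : T -> U) :
  UltraFilter F -> UltraFilter (f @ F).
Proof.
move=> FU; apply: ultra_filterP => A.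
exact: (in_ultra_setVsetC (f @^-1` A) FU).
Qed.

(** The Fubini product of two ultrafilters: limits along it are iterated limits. *)
Definition iterated_filter (S T : Type) (F : set_system S) (G : set_system T) :
    set_system (S * T) :=
  fun A => \forall s \near F, \forall t \near G, A (s, t).

Lemma iterated_filter_ultra (S T : Type) (F : set_system S) (G : set_system T) :
  UltraFilter F -> UltraFilter G -> UltraFilter (iterated_filter F G).
Proof.
move=> FU GU; apply: ultra_filterP.
  apply: Build_ProperFilter_ex.
    move=> A; rewrite /iterated_filter => AFG.
    have [s Gs] := filter_ex AFG; have [t Ast] := filter_ex Gs.
    by exists (s, t).
  split; rewrite /iterated_filter.
  - by apply: filterE => s; apply: filterE.
  - by move=> A B; apply: filterS2 => s; apply: filterS2 => t.
  - by move=> A B AB; apply: filterS => s; apply: filterS => t; exact: AB.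
move=> A; have [|/(ultra_not FU) nA] := pselect (iterated_filter F G A).
  by left.
by right; apply: filterS nA => s /(ultra_not GU).
Qed.

Lemma iterated_filter_snd (S T : Type) (F : set_system S) (G : set_system T)
    (P : set (S * T)) : Filter F -> (forall s, \forall t \near G, P (s, t)) ->
  \forall p \near iterated_filter F G, P p.
Proof. by move=> FF PG; exact: (@filterE _ F). Qed.

Lemma ex_ultra_infty : exists U : set_system nat, UltraFilter U /\
  forall n : nat, \forall m \near U, (n < m)%N.
Proof.
have [U [UU oU]] := @ultraFilterLemma nat \oo _.
by exists U; split=> // n; apply: oU; exists n.+1.
Qed.

Variable R : realType.

Lemma ultra_cvg_bounded (T : Type) (F : set_system T) (u : T -> R) (M : R) :
  UltraFilter F -> (\forall t \near F, `|u t| <= M) ->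
  exists l : R, u t @[t --> F] --> l.
Proof.
move=> FU uM; have := @segment_compact R (- M) M.
rewrite compact_ultra => /(_ _ (fmap_ultra u FU)) [|l [_ ul]]; last by exists l.
by apply: filterS uM => t /=; rewrite in_itv /= ler_norml.
Qed.

End Ultrafilters.

Section WeakStarLimits.
Variables (R : realType) (E : normedModType R).

Lemma dual_apply_le (phi : dual E) (M : R) x :
  `|phi| <= M -> `|phi x| <= M * `|x|.
Proof.
move=> phiM; apply: le_trans (ler_dual_norm phi x) _.
by apply: ler_wpM2r; first exact: normr_ge0.
Qed.

Lemma dual_applyD (f : dual E) x y : f @@ (x + y) = f @@ x + f @@ y.
Proof. exact: (linearD f). Qed.

Lemma dual_applyB (f : dual E) x y : f @@ (x - y) = f @@ x - f @@ y.
Proof. exact: (linearB f). Qed.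

Lemma dual_applyZ (f : dual E) (a : R) x : f @@ (a *: x) = a * f @@ x.
Proof. by have := dual_linear f a x 0; rewrite linear0 !addr0. Qed.

Definition weak_star_cvg (T : Type) (F : set_system T) (phi : T -> dual E)
  (psi : dual E) : Prop := forall x, phi t x @[t --> F] --> psi x.

Lemma ex_weak_star_limit (T : Type) (F : set_system T) (phi : T -> dual E)
    (M : R) : UltraFilter F -> (forall t, `|phi t| <= M) ->
  exists2 psi : dual E, `|psi| <= M & weak_star_cvg F phi psi.
Proof.
move=> FU phiM.
have phix t x : `|phi t x| <= M * `|x|.
  exact: dual_apply_le.
have exl x : exists l : R, phi t x @[t --> F] --> l.
  apply: (@ultra_cvg_bounded _ _ _ (fun t => phi t x : R) (M * `|x|) FU).
  by apply: filterE => t; exact: phix.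
have [l lP] := choice exl.
have ll : linear (l : E -> R^o).
  move=> a x y.
  have H : phi t (a *: x + y) @[t --> F] --> (a * l x + l y : R).
    under eq_fun do rewrite linearP.
    by apply: cvgD; [apply: cvgMl_tmp; exact: lP|exact: lP].
  exact: (cvg_unique _ (lP _) H).
have lM x : `|l x| <= M * `|x|.
  have /cvg_norm nl := lP x.
  by apply: (cvgr_to_le nl); apply: filterE => t; exact: phix.
pose L : {linear E -> R^o} :=
  HB.pack (l : E -> R^o) (GRing.isLinear.Build R E R^o _ l ll).
have [t0 _] := filter_ex (@filterT _ F _).
have M0 : 0 <= M by apply: le_trans (phiM t0).
have lc : continuous (l : E -> R^o).
  apply: (@bounded_linear_continuous _ _ _ L); apply/bounded_funP => r.
  by exists (M * r) => x xr; apply: le_trans (lM x) _; rewrite ler_wpM2l.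
have lf : (l : E -> R^o) \in @is_functional R E by exact/is_functionalP.
exists (Dual lf) => //.
apply: dual_norm_le => x x1; apply: le_trans (lM x) _.
by rewrite ler_piMr.
Qed.

End WeakStarLimits.

(** * Szlenk derivations along ultrafilters *)

Section Szlenk.
Variables (R : realType) (E : normedModType R).
Implicit Types (K : set (dual E)).

Lemma weak_star_open_near (T : Type) (F : set_system T) (phi : T -> dual E)
    (psi : dual E) (U : set (weak_star E)) : Filter F ->
  weak_star_cvg F phi psi -> open U -> U psi -> \forall t \near F, U (phi t).
Proof.
move=> FF cv [V oV <-] /= Vpsi.
pose toptws (f : dual E) : {ptws E -> R^o} := f : E -> R^o.
have cvp : {ptws, toptws (phi t) @[t --> F] --> toptws psi}.
  by apply/pointwise_cvgP => x; exact: cv.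
by apply: cvp; apply: open_nbhs_nbhs.
Qed.

(** For subsets of a ball of the dual this amounts to weak star compactness. *)
Definition ultraclosed K : Prop :=
  forall (T : Type) (F : set_system T) (phi : T -> dual E) (psi : dual E),
    UltraFilter F -> (\forall t \near F, K (phi t)) ->
    weak_star_cvg F phi psi -> K psi.

(** A point removed by the derivation has a neighbourhood of diameter at most
    [eps] that is removed with it; most terms of a family converging to that point
    lie in this neighbourhood. *)
Lemma not_szlenk_deriv_near (T : Type) (F : set_system T) eps K
    (phi : T -> dual E) (psi : dual E) :
  UltraFilter F -> (\forall t \near F, K (phi t)) -> weak_star_cvg F phi psi ->
  K psi -> ~ szlenk_deriv eps K psi ->
  \forall t \near F, ~ szlenk_deriv eps K (phi t) /\ `|phi t - psi| <= eps.
Proof.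
move=> FU Kphi cv Kpsi nd.
have [_ [[U oU ->] diamV] [_ Upsi]] : (\bigcup_(V in [set V |
    weak_star_open_in K V /\ (norm_diam V <= eps%:E)%E]) V) psi.
  by apply: contrapT => h; apply: nd.
have Uphi : \forall t \near F, U (phi t).
  exact: weak_star_open_near cv oU Upsi.
move: Kphi Uphi; apply: filterS2 => t Kt Ut; split.
  case=> _; apply; exists (K `&` U) => //; split=> //; by exists U.
rewrite -lee_fin; apply: le_trans diamV; apply: ereal_sup_ubound.
by exists (phi t, psi).
Qed.

Lemma szlenk_deriv_ultraclosed eps K :
  ultraclosed K -> ultraclosed (szlenk_deriv eps K).
Proof.
move=> Kcl T F phi psi FU dphi cv.
have Kphi : \forall t \near F, K (phi t) by apply: filterS dphi => t [].
have Kpsi := Kcl _ _ _ _ FU Kphi cv.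
apply: contrapT => /(not_szlenk_deriv_near FU Kphi cv Kpsi) H.
by have [t [dt [ndt _]]] := filter_ex (filterI dphi H).
Qed.

Lemma ball_ultraclosed (M : R) : ultraclosed [set f : dual E | `|f| <= M].
Proof.
move=> T F phi psi FU phiM cv; apply: dual_norm_le => x x1.
have /cvg_norm nl := cv x; apply: (cvgr_to_le nl).
apply: filterS phiM => t /= tM; apply: le_trans (dual_apply_le x tM) _.
by rewrite ler_piMr// (le_trans _ tM)// normr_ge0.
Qed.

Lemma szlenk_iter_sub eps K a : szlenk_iter eps K a `<=` K.
Proof. by elim: a => [//|a IHa|J f IHf] x /= [] // /IHa. Qed.

Lemma szlenk_deriv_mono eps K L :
  K `<=` L -> szlenk_deriv eps K `<=` szlenk_deriv eps L.
Proof.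
move=> KL x [Kx nx]; split; first exact: KL.
case=> _ [[U oU ->] diamV] [_ Ux]; apply: nx; exists (K `&` U) => //.
split; first by exists U.
apply: le_trans diamV; apply: le_ereal_sup => _ [[p q] [[Kp Up] [Kq Uq]] <-].
by exists (p, q) => //; split; split=> //; exact: KL.
Qed.

Lemma szlenk_iter_ole eps K a b :
  ole a b -> szlenk_iter eps K b `<=` szlenk_iter eps K a.
Proof.
elim: a b => [b _|a IHa b|J f IHf b fb]; first exact: szlenk_iter_sub.
  elim: b => [//|b _|J g IHg] /=.
    by move=> ab; apply: szlenk_deriv_mono; exact: IHa.
  by case=> i agi x [_ gx]; apply: (IHg i agi); exact: gx.
move=> x bx; split; first exact: szlenk_iter_sub bx.
by move=> i _; exact: IHf (fb i) _ bx.
Qed.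

Lemma szlenk_iter_nat_ultraclosed eps K n :
  ultraclosed K -> ultraclosed (szlenk_iter eps K (ord_nat n)).
Proof.
by move=> Kcl; elim: n => // n IHn; exact: szlenk_deriv_ultraclosed.
Qed.

Lemma szlenk_iter_nat_le eps K m n : (m <= n)%N ->
  szlenk_iter eps K (ord_nat n) `<=` szlenk_iter eps K (ord_nat m).
Proof.
elim: n => [|n IHn]; first by rewrite leqn0 => /eqP->.
rewrite leq_eqVlt => /predU1P[->//|mn] x [nx _]; exact: IHn.
Qed.

Definition dual_ball : set (dual E) := [set f | `|f| <= 1].

(** A point chosen in each of infinitely many decreasing nonempty derived sets
    would have a limit lying in all of them, that is in the derived set of order
    [omega]. *)
Lemma szlenk_index_omega_finite : eole (szlenk_index E) (Some omega) ->
  forall eps : R, 0 < eps ->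
    exists n, szlenk_iter eps dual_ball (ord_nat n) = set0.
Proof.
move=> szE eps eps0.
have [a a0 aw] : exists2 a, szlenk_iter eps dual_ball a = set0 & ole a omega.
  move: szE; rewrite /szlenk_index /szlenk_set /eord_sup.
  case: pselect => // nN H.
  have := H (exist _ eps eps0) => /=.
  have := nN; rewrite -forallNE => /(_ (exist _ eps eps0)) /=.
  rewrite /szlenk_eps /eord_inf; case: pselect => // exa _.
  by case: cid => /= a [a0 _] aw; exists a.
apply: contrapT => /forallNP ne.
have exf n : exists f, szlenk_iter eps dual_ball (ord_nat n) f.
  by apply/set0P/eqP; exact: ne.
have [f fP] := choice exf.
have [U [UU Uinf]] := ex_ultra_infty.
have fb n : `|f n| <= 1 by apply: szlenk_iter_sub (fP n).
have [g g1 fg] := ex_weak_star_limit UU fb.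
suff : szlenk_iter eps dual_ball a g by rewrite a0.
apply: (szlenk_iter_ole aw); split => // n _.
apply: (szlenk_iter_nat_ultraclosed (@ball_ultraclosed 1) UU _ fg).
have := Uinf n.
by apply: filterS => m nm; exact: (szlenk_iter_nat_le (ltnW nm) (fP m)).
Qed.
End Szlenk.
Arguments dual_ball {R} E _.

(** * Norms measuring weakly null perturbations *)

Section UpperNorms.
Variables (R : realType) (E : normedModType R) (tau : R).
Hypothesis tau0 : 0 <= tau.
Implicit Types (phi psi : E) (W : set_system E).

Definition weakly_null W : Prop :=
  [/\ UltraFilter W, \forall psi \near W, `|psi| <= 1 &
      forall x : dual E, x psi @[psi --> W] --> (0 : R)].

Lemma weakly_null_principal : weakly_null (principal_filter (0 : E)).
Proof.
split; first exact: principal_filter_ultra.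
  by apply/principal_filterP; rewrite /= normr0.
move=> x; apply/cvgrPdist_lt => e e0; apply/principal_filterP => /=.
by rewrite linear0 subrr normr0.
Qed.

Definition perturbed_limits (N : E -> R) phi : set R :=
  [set r | exists2 W, weakly_null W & N (phi + tau *: psi) @[psi --> W] --> r].

(** The largest limit norm reached from [phi] by adding [k] successive weakly null
    perturbations of size [tau].  The recursion over weakly null ultrafilters
    replaces suprema over weakly null trees of height [k]. *)
Fixpoint upper_norm (k : nat) phi : R :=
  if k is k'.+1 then sup (perturbed_limits (upper_norm k') phi) else `|phi|.

Lemma perturbed_limits_self (N : E -> R) phi : perturbed_limits N phi (N phi).
Proof.
exists (principal_filter 0); first exact: weakly_null_principal.
apply/cvgrPdist_lt => e e0; apply/principal_filterP => /=.
by rewrite scaler0 addr0 subrr normr0.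
Qed.

Section NearTheNorm.
Variables (N : E -> R) (c : R).
Hypothesis N_norm : forall phi, `|phi| <= N phi <= `|phi| + c.

Lemma perturbed_near phi W : weakly_null W ->
  \forall psi \near W, `|N (phi + tau *: psi)| <= `|phi| + (c + tau).
Proof.
move=> [WU W1 _]; apply: filterS W1 => psi psi1.
have /andP[h1 h2] := N_norm (phi + tau *: psi).
rewrite ger0_norm ?(le_trans _ h1)//; apply: le_trans h2 _.
rewrite (addrC c) addrA lerD2r; apply: le_trans (ler_normD _ _) _.
by rewrite lerD2l normrZ ger0_norm//; exact: ler_piMr.
Qed.

Lemma perturbed_limits_ubound phi :
  ubound (perturbed_limits N phi) (`|phi| + (c + tau)).
Proof.
move=> r [W Wn Wr]; have [WU _ _] := Wn.
apply: (cvgr_to_le Wr); apply: filterS (perturbed_near phi Wn) => psi.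
exact: le_trans (ler_norm _).
Qed.

Lemma perturbed_limits_has_sup phi : has_sup (perturbed_limits N phi).
Proof.
split; first by exists (N phi); exact: perturbed_limits_self.
by exists (`|phi| + (c + tau)); exact: perturbed_limits_ubound.
Qed.

End NearTheNorm.

Lemma upper_norm_bounds k phi :
  `|phi| <= upper_norm k phi <= `|phi| + k%:R * tau.
Proof.
elim: k phi => [|k IHk] phi; first by rewrite mul0r addr0 lexx.
have hs := perturbed_limits_has_sup IHk phi; apply/andP; split.
  have /andP[h _] := IHk phi; apply: le_trans h _.
  by apply: sup_upper_bound => //; exact: perturbed_limits_self.
rewrite -natr1 mulrDl mul1r; apply: ge_sup; first by case: hs.
exact: perturbed_limits_ubound.
Qed.

Let has_sup_limits k phi : has_sup (perturbed_limits (upper_norm k) phi).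
Proof. exact: (perturbed_limits_has_sup (upper_norm_bounds k)). Qed.

Lemma ex_upper_norm_limit k phi W : weakly_null W ->
  exists2 r, upper_norm k (phi + tau *: psi) @[psi --> W] --> r &
             r <= upper_norm k.+1 phi.
Proof.
move=> Wn; have WU : UltraFilter W by case: Wn.
have [r Wr] := ultra_cvg_bounded WU
  (perturbed_near (upper_norm_bounds k) phi Wn).
exists r => //; apply: sup_upper_bound; first exact: has_sup_limits.
by exists W.
Qed.

Lemma upper_norm_convex k (a b : R) phi phi' : 0 <= a -> 0 <= b -> a + b = 1 ->
  upper_norm k (a *: phi + b *: phi') <=
  a * upper_norm k phi + b * upper_norm k phi'.
Proof.
move=> a0 b0 ab1; elim: k phi phi' => [|k IHk] phi phi'.
  apply: le_trans (ler_normD _ _) _.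
  by rewrite !normrZ !ger0_norm.
apply: ge_sup; first by have [] := has_sup_limits k (a *: phi + b *: phi').
move=> r [W Wn Wr]; have WU : UltraFilter W by case: Wn.
have [s Ws sN] := ex_upper_norm_limit k phi Wn.
have [t Wt tN] := ex_upper_norm_limit k phi' Wn.
apply: (@le_trans _ _ (a * s + b * t)); last first.
  by apply: lerD; rewrite ler_wpM2l.
have Wst : a * upper_norm k (phi + tau *: psi) +
    b * upper_norm k (phi' + tau *: psi) @[psi --> W] --> a * s + b * t.
  by apply: cvgD; apply: cvgMl_tmp.
rewrite -subr_ge0; apply: (cvgr_to_ge (cvgB Wst Wr)).
apply: filterE => psi /=; rewrite subr_ge0; apply: le_trans (IHk _ _).
rewrite le_eqVlt; apply/orP; left; apply/eqP; congr upper_norm.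
rewrite !scalerDr addrACA; congr (_ + _).
by rewrite -scalerDl ab1 scale1r.
Qed.

(** A perturbation that raises the norm by more than [tau * eps] moves the point
    of the dual ball where the norm is attained by more than [eps].  The limit [x]
    of these points is then one derived set deeper, which is recorded by [i] and
    happens fewer than [n] times. *)
Lemma upper_norm_szlenk (n : nat) (eps : R) : 0 <= eps ->
  szlenk_iter eps (dual_ball E) (ord_nat n) = set0 ->
  forall (k : nat) phi (kappa : R), 0 < kappa ->
  exists i (x : dual E), szlenk_iter eps (dual_ball E) (ord_nat i) x /\
    upper_norm k phi <= x @@ phi + i%:R * (2 * tau) + k%:R * (tau * eps) + kappa.
Proof.
move=> eps0 sn0; elim=> [|k IHk] phi kappa kappa0.
  have [x [x1 xphi]] := hahn_banach_norming phi.
  by exists 0%N, x; split=> //=; rewrite xphi !mul0r; lra.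
have k4 : 0 < kappa / 4 by lra.
have [r [W Wn Wr] kr] := sup_adherent k4 (has_sup_limits k phi).
have {}kr : upper_norm k.+1 phi < r + kappa / 4 by rewrite -ltrBlDr.
have [WU W1 W0] := Wn.
pose good (i : nat) (x : dual E) psi :=
  szlenk_iter eps (dual_ball E) (ord_nat i) x /\
  upper_norm k (phi + tau *: psi) <=
  x @@ (phi + tau *: psi) + i%:R * (2 * tau) + k%:R * (tau * eps) + kappa / 4.
have exg psi : exists x, exists2 i, (i < n)%N & good i x psi.
  have [i [x [ix xr]]] := IHk (phi + tau *: psi) _ k4.
  exists x, i => //; rewrite ltnNge; apply/negP => ni.
  by have := szlenk_iter_nat_le ni ix; rewrite sn0.
have [x xP] := choice exg.
have [i iltn gi] := ultra_exists_lt WU (filterE _ xP).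
have xb psi : `|x psi| <= 1.
  by have [j _ [jx _]] := xP psi; exact: szlenk_iter_sub jx.
have [y y1 xy] := ex_weak_star_limit WU xb.
have ix : \forall psi \near W, szlenk_iter eps (dual_ball E) (ord_nat i) (x psi).
  by apply: filterS gi => psi [].
have Bcl (j : nat) : ultraclosed (szlenk_iter eps (dual_ball E) (ord_nat j)).
  by apply: szlenk_iter_nat_ultraclosed; exact: ball_ultraclosed.
have iy := Bcl _ _ _ _ _ WU ix xy.
(* the estimate common to both cases, [d] bounding the jump *)
have est (d : R) : 0 <= d -> (\forall psi \near W, `|x psi - y| <= d) ->
    upper_norm k.+1 phi <=
      y @@ phi + i%:R * (2 * tau) + tau * d + k%:R * (tau * eps) + kappa.
  move=> d0 xyd.
  have t1 : 0 < tau + 1 by rewrite ltr_wpDl.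
  have e1 : \forall psi \near W, `|y @@ phi - x psi @@ phi| < kappa / 8.
    by move: (xy phi) => /cvgrPdist_lt; apply; lra.
  have e2 : \forall psi \near W, `|0 - y @@ psi| < kappa / (8 * (tau + 1)).
    by move: (W0 y) => /cvgrPdist_lt; apply; rewrite divr_gt0// mulr_gt0.
  have e3 : \forall psi \near W,
      `|r - upper_norm k (phi + tau *: psi)| < kappa / 4.
    by move: Wr => /cvgrPdist_lt; apply; lra.
  have [psi [[/= h1 h2] [h3 [[_ h4] [h5 h6]]]]] := filter_ex
    (filterI (filterI e1 e2) (filterI e3 (filterI gi (filterI xyd W1)))).
  have h7 : x psi @@ psi - y @@ psi <= d.
    apply: le_trans (ler_norm _) _.
    by apply: le_trans (dual_apply_le psi h5) _; rewrite ler_piMr.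
  have h8 : tau * y @@ psi <= kappa / 8.
    have : y @@ psi <= kappa / (8 * (tau + 1)).
      by apply/ltW; apply: le_lt_trans h2; rewrite sub0r normrN ler_norm.
    rewrite invfM mulrA => /(ler_wpM2l tau0) /le_trans; apply.
    rewrite mulrCA ler_piMr//; first lra.
    by rewrite ler_pdivrMr// mul1r; lra.
  have h9 : tau * (x psi @@ psi - y @@ psi) <= tau * d by rewrite ler_wpM2l.
  have h10 : x psi @@ (phi + tau *: psi) = x psi @@ phi + tau * x psi @@ psi.
    by rewrite linearD linearZ.
  move: h1 h3; rewrite !ltr_norml => /andP[h1 _] /andP[_ h3].
  move: h4 h9; rewrite h10 mulrBr => h4 h9.
  rewrite -/(upper_norm k.+1 phi).
  by move: kr h1 h3 h4 h8 h9; clear; lra.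
have [iy'|iy'] := pselect (szlenk_iter eps (dual_ball E) (ord_nat i.+1) y).
  exists i.+1, y; split=> //.
  apply: (le_trans (est 2 _ _)) => //.
    by apply: filterE => psi; apply: le_trans (ler_normB _ _) _; have := xb psi; lra.
  have : 0 <= tau * eps by rewrite mulr_ge0.
  rewrite -!natr1 !mulrDl !mul1r; lra.
exists i, y; split=> //.
have := not_szlenk_deriv_near WU ix xy iy iy' => nd.
apply: (le_trans (est eps _ _)) => //; first by apply: filterS nd => psi [].
rewrite -!natr1 !mulrDl !mul1r; lra.
Qed.

Lemma upper_norm_le (n : nat) (eps : R) : 0 <= eps ->
  szlenk_iter eps (dual_ball E) (ord_nat n) = set0 ->
  forall (k : nat) phi,
    upper_norm k phi <= `|phi| + n%:R * (2 * tau) + k%:R * (tau * eps).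
Proof.
move=> eps0 sn0 k phi; apply/ler_addgt0Pr => kappa kappa0.
have [i [x [ix xk]]] := upper_norm_szlenk eps0 sn0 k phi kappa0.
have iln : (i <= n)%N.
  rewrite leqNgt; apply/negP => ni.
  by have := szlenk_iter_nat_le (ltnW ni) ix; rewrite sn0.
apply: le_trans xk _; rewrite !lerD2r; apply: lerD.
  apply: le_trans (ler_norm _) _; apply: le_trans (ler_dual_norm _ _) _.
  by rewrite ler_piMl//; exact: szlenk_iter_sub ix.
by rewrite ler_wpM2r ?mulr_ge0// ler_nat.
Qed.

End UpperNorms.

(** * From asymptotic smoothness to asymptotic convexity *)

Section MeanNorm.
Variables (R : realType) (E : normedModType R) (tau : R) (k : nat).
Hypotheses (tau0 : 0 <= tau) (k0 : (0 < k)%N).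
Implicit Types (phi psi : E).

(** As [upper_norm tau k] exceeds the norm by a bounded multiple of [tau] plus
    [k * tau * eps], the increments [upper_norm tau i.+1 - upper_norm tau i] are of
    order [tau * eps] on average over [i < k], for large [k]. *)
Definition mean_norm phi : R :=
  k%:R^-1 * \sum_(i < k) upper_norm tau i phi.

Let kr0 : 0 < k%:R :> R. Proof. by rewrite ltr0n. Qed.

Lemma mean_le_mean (u v : nat -> R) :
  (forall i, (i < k)%N -> u i <= v i) ->
  k%:R^-1 * (\sum_(i < k) u i) <= k%:R^-1 * \sum_(i < k) v i.
Proof.
by move=> uv; rewrite ler_pM2l ?invr_gt0//; apply: ler_sum => i _; exact: uv.
Qed.

Lemma mean_cst (c : R) : k%:R^-1 * (\sum_(i < k) c) = c.
Proof.
by rewrite sumr_const card_ord -(mulr_natl c) mulrA mulVf ?mul1r// gt_eqF.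
Qed.

Lemma mean_norm_bounds phi : `|phi| <= mean_norm phi <= `|phi| + k%:R * tau.
Proof.
apply/andP; split.
  rewrite -[leLHS]mean_cst.
  apply: (@mean_le_mean (fun=> `|phi|) (upper_norm tau ^~ phi)) => i _.
  by have /andP[] := upper_norm_bounds tau0 i phi.
rewrite -[leRHS]mean_cst.
apply: (@mean_le_mean (upper_norm tau ^~ phi) (fun=> _)) => i ik.
have /andP[_ h] := upper_norm_bounds tau0 i phi; apply: le_trans h _.
by rewrite lerD2l ler_wpM2r// ler_nat ltnW.
Qed.

Lemma mean_norm_convex (a b : R) phi phi' : 0 <= a -> 0 <= b -> a + b = 1 ->
  mean_norm (a *: phi + b *: phi') <= a * mean_norm phi + b * mean_norm phi'.
Proof.
move=> a0 b0 ab1; rewrite /mean_norm (mulrCA a) (mulrCA b) -mulrDr.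
rewrite (mulr_sumr _ _ _ a) (mulr_sumr _ _ _ b) -big_split /=.
apply: (@mean_le_mean (upper_norm tau ^~ _)
  (fun i => a * upper_norm tau i phi + b * upper_norm tau i phi')) => i _.
exact: upper_norm_convex.
Qed.

(** A perturbation replaces each [upper_norm tau i] by at most
    [upper_norm tau i.+1], so it raises the mean by at most the [k]-th part of
    [upper_norm tau k - upper_norm tau 0]. *)
Lemma mean_norm_perturb (n : nat) (eps kappa : R) (W : set_system E) phi :
  0 <= eps -> szlenk_iter eps (dual_ball E) (ord_nat n) = set0 ->
  weakly_null W -> 0 < kappa ->
  \forall psi \near W,
    mean_norm (phi + tau *: psi) <=
    mean_norm phi + (2 * n%:R / k%:R + eps) * tau + kappa.
Proof.
move=> eps0 sn0 Wn kappa0; have [WU _ _] := Wn.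
have : \forall psi \near W, forall i, (i < k)%N ->
    upper_norm tau i (phi + tau *: psi) <= upper_norm tau i.+1 phi + kappa.
  apply: filter_forall_lt => i _.
  have [r /cvgrPdist_lt /(_ _ kappa0) Wr ri] := ex_upper_norm_limit tau0 i phi Wn.
  apply: filterS Wr => psi; rewrite distrC => /ltr_distlDr /ltW h.
  by apply: le_trans h _; rewrite lerD2r.
apply: filterS => psi H; apply: le_trans (mean_le_mean H) _.
rewrite big_split mulrDr mean_cst lerD2r.
have -> : \sum_(i < k) upper_norm tau i.+1 phi =
    \sum_(i < k) upper_norm tau i phi + (upper_norm tau k phi - `|phi|).
  have := telescope_sumr (upper_norm tau ^~ phi) (leq0n k).
  by rewrite big_mkord sumrB /= => <-; rewrite addrC subrK.
rewrite mulrDr lerD2l.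
have h := upper_norm_le tau0 eps0 sn0 k phi.
apply: (@le_trans _ _ (k%:R^-1 * (n%:R * (2 * tau) + k%:R * (tau * eps)))).
  rewrite ler_pM2l ?invr_gt0//; move: h; clear; lra.
rewrite le_eqVlt; apply/orP; left; apply/eqP; field.
by rewrite gt_eqF.
Qed.

End MeanNorm.

Section AsymptoticConvexity.
Variables (R : realType) (E : normedModType R).

Lemma ex_gt_dual (f : dual E) (r : R) :
  r < `|f| -> exists psi : E, `|psi| <= 1 /\ r < f @@ psi.
Proof.
move=> rf; apply: contrapT => /forallNP nf; move: rf; apply/negP; rewrite -leNgt.
apply: dual_norm_le => x x1; rewrite ler_norml.
have H y : `|y| <= 1 -> f @@ y <= r.
  by move=> y1; rewrite leNgt; apply/negP => ry; apply: (nf y).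
by rewrite H// andbT lerNl -[leLHS](linearN f) H ?normrN.
Qed.

(** Asymptotic uniform convexity of the norm [sup_C] of [dual E] for the weak star
    topology, at the single separation [eps]. *)
Definition asymptotically_convex (C : set E) (eps delta : R) : Prop :=
  forall (T : Type) (F : set_system T) (x : T -> dual E) (y : dual E) (rho : R),
    UltraFilter F -> 0 < rho ->
    (\forall t \near F, forall phi, C phi -> x t @@ phi <= rho) ->
    weak_star_cvg F x y -> (\forall t \near F, eps * rho < `|x t - y|) ->
    forall phi, C phi -> y @@ phi <= (1 - delta) * rho.

Lemma weakly_null_half_diff (T : Type) (F : set_system T) (psi : T -> E) :
  UltraFilter F -> (forall t, `|psi t| <= 1) ->
  weakly_null ((2^-1 : R) *: (psi p.2 - psi p.1) @[p --> iterated_filter F F]).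
Proof.
move=> FU psi1; have FFU := iterated_filter_ultra FU FU.
split; first exact: fmap_ultra.
  suff : \forall p \near iterated_filter F F,
      `|(2^-1 : R) *: (psi p.2 - psi p.1)| <= 1 by [].
  apply: filterE => -[s t] /=; rewrite normrZ ger0_norm ?invr_ge0//.
  rewrite ler_pdivrMl// mulr1; apply: le_trans (ler_normB _ _) _.
  by have := psi1 s; have := psi1 t; lra.
move=> x.
have [l xl] : exists l : R, x @@ psi t @[t --> F] --> l.
  apply: (@ultra_cvg_bounded R _ F (fun t => x @@ psi t) `|x|) => //.
  apply: filterE => t; apply: le_trans (ler_dual_norm _ _) _.
  by apply: ler_piMr; [exact: dual_norm_ge0|exact: psi1].
apply/cvgrPdist_lt => e e0.
have h : \forall t \near F, `|l - x @@ psi t| < e.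
  by move/cvgrPdist_lt : xl; exact.
suff : \forall p \near iterated_filter F F,
    `|0 - x @@ ((2^-1 : R) *: (psi p.2 - psi p.1))| < e by [].
have : \forall p \near iterated_filter F F,
    `|l - x @@ psi p.1| < e /\ `|l - x @@ psi p.2| < e.
  by apply: filterS (h) => s hs; apply: filterS h => t ht.
apply: filterS => -[s t] /= [hs ht].
have -> : x @@ (2^-1 *: (psi t - psi s)) = 2^-1 * (x @@ psi t - x @@ psi s).
  by rewrite dual_applyZ dual_applyB.
rewrite sub0r normrN normrM ger0_norm ?invr_ge0//.
move: hs ht; rewrite !ltr_norml => /andP[? ?] /andP[? ?].
by rewrite ltr_pdivrMl// ltr_norml; apply/andP; split; lra.
Qed.

(** The unit ball of [mean_norm] has this property.  An element [phi] of the ball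
    is perturbed by a small multiple of [psi t - psi s], where [psi t] norms
    [x t - y]: smoothness keeps the perturbation in the ball up to a factor, while
    its value at [x t] exceeds [y phi] by more than this factor allows. *)
Lemma ex_asymptotically_convex (eps : R) : 0 < eps ->
  (forall e : R, 0 < e ->
    exists n, szlenk_iter e (dual_ball E) (ord_nat n) = set0) ->
  exists (C : set E) (delta : R),
    [/\ 0 < delta, forall phi, C phi -> `|phi| <= 1,
        forall phi, `|phi| <= 2^-1 -> C phi & asymptotically_convex C eps delta].
Proof.
move=> eps0 sz.
(* the perturbation gains almost [tau / 2 * eps] at [x t], and smoothness costs a
   few multiples of [tau * e] *)
pose e : R := eps / 16.
have e0 : 0 < e by rewrite divr_gt0.
have [n sn0] := sz e e0.
have [k k0 kn] : exists2 k, (0 < k)%N & 2 * n%:R / k%:R <= e.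
  exists (Num.bound (2 * n%:R / e)).+1 => //.
  rewrite ler_pdivrMr ?ltr0n// -ler_pdivrMl// mulrC.
  apply/ltW/(lt_trans (archi_boundP _)); last by rewrite ltr_nat.
  by rewrite divr_ge0 ?mulr_ge0 ?ler0n// ltW.
have kr0 : 0 < k%:R :> R by rewrite ltr0n.
(* so small that [mean_norm] exceeds the norm by at most [1 / 2] *)
pose tau : R := (2 * k%:R)^-1.
have tau0 : 0 < tau by rewrite invr_gt0 mulr_gt0.
have ktau : k%:R * tau = 2^-1 by rewrite /tau invfM mulrCA mulfV ?mulr1// gt_eqF.
pose N := @mean_norm R E tau k.
have Nb phi : `|phi| <= N phi <= `|phi| + 2^-1.
  by rewrite -ktau; exact: mean_norm_bounds (ltW tau0) k0 phi.
exists [set phi | N phi <= 1], (tau * e); split.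
- by rewrite mulr_gt0.
- by move=> phi /=; have /andP[h _] := Nb phi; exact: le_trans.
- by move=> phi h /=; have /andP[_ h'] := Nb phi; move: h h'; clear; lra.
move=> T F x y rho FU rho0 xrho xy xgap phi /= phi1.
pose good t psi := `|psi| <= 1 /\ (eps * rho < `|x t - y| ->
  eps * rho < x t @@ psi - y @@ psi).
have exg t : exists psi, good t psi.
  have [h|h] := pselect (eps * rho < `|x t - y|).
    by have [psi [p1 p2]] := ex_gt_dual h; exists psi.
  by exists 0; split=> //; rewrite normr0.
have [psi psiP] := choice exg.
have psi1 t : `|psi t| <= 1 by case: (psiP t).
have Wn := weakly_null_half_diff FU psi1.
have FFU := iterated_filter_ultra FU FU.
have [l yl] : exists l : R, y @@ psi t @[t --> F] --> l.
  apply: (@ultra_cvg_bounded R _ F (fun t => y @@ psi t) `|y|) => //.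
  apply: filterE => t; apply: le_trans (ler_dual_norm _ _) _.
  by apply: ler_piMr; [exact: dual_norm_ge0|exact: psi1].
have te0 : 0 < tau * e by rewrite mulr_gt0.
have near_smooth : \forall p \near iterated_filter F F,
    N (phi + tau *: (2^-1 *: (psi p.2 - psi p.1))) <= 1 + 3 * (tau * e).
  have : \forall p \near iterated_filter F F,
      N (phi + tau *: (2^-1 *: (psi p.2 - psi p.1))) <=
      N phi + (2 * n%:R / k%:R + e) * tau + tau * e.
    exact: (mean_norm_perturb (ltW tau0) k0 phi (ltW e0) sn0 Wn te0).
  apply: filterS => p /le_trans; apply.
  have h : (2 * n%:R / k%:R + e) * tau <= (e + e) * tau.
    by apply: ler_wpM2r; [exact: ltW|rewrite lerD2r].
  by move: h phi1; rewrite -/(N phi); clear; lra.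
have er0 : 0 < e * rho / 3 by rewrite divr_gt0// mulr_gt0.
have yl' : \forall t \near F, `|l - y @@ psi t| < e * rho / 3.
  by move/cvgrPdist_lt : yl; exact.
have near_s : \forall p \near iterated_filter F F, `|l - y @@ psi p.1| < e * rho / 3.
  by apply: filterS yl' => s hs; apply: filterE.
have near_t : \forall p \near iterated_filter F F, `|l - y @@ psi p.2| < e * rho / 3.
  by apply: iterated_filter_snd => s; exact: yl'.
have near_cross : \forall p \near iterated_filter F F,
    `|y @@ psi p.1 - x p.2 @@ psi p.1| < e * rho / 3.
  apply: iterated_filter_snd => s.
  by move: (xy (psi s)) => /cvgrPdist_lt /(_ _ er0).
have near_phi : \forall p \near iterated_filter F F,
    `|y @@ phi - x p.2 @@ phi| < tau * (e * rho / 3).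
  apply: iterated_filter_snd => s; move: (xy phi) => /cvgrPdist_lt; apply.
  exact: mulr_gt0.
have near_gap : \forall p \near iterated_filter F F, eps * rho < `|x p.2 - y|.
  by apply: iterated_filter_snd => s; exact: xgap.
have near_rho : \forall p \near iterated_filter F F,
    forall phi, N phi <= 1 -> x p.2 @@ phi <= rho.
  by apply: iterated_filter_snd => s; exact: xrho.
have [[s t] [[/= h1 [h2 h3]] [[h4 h5] [h6 h7]]]] := filter_ex (filterI
  (filterI near_smooth (filterI near_s near_t))
  (filterI (filterI near_cross near_phi) (filterI near_gap near_rho))).
have {h6} h6 := (psiP t).2 h6.
set Phi := phi + _ in h1.
pose sg := 3 * (tau * e).
have sg0 : 0 < sg by rewrite mulr_gt0.
pose lam := (1 + 2 * sg)^-1.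
have s1 : 0 < 1 + 2 * sg by rewrite addr_gt0// mulr_gt0.
have lam0 : 0 < lam by rewrite invr_gt0.
have lam1 : 0 <= 1 - lam.
  by rewrite subr_ge0 invf_le1// lerDl mulr_ge0// ltW.
have lams : lam * (1 + 2 * sg) = 1 by rewrite mulVf ?gt_eqF.
have /h7 : N (lam *: Phi) <= 1.
  have := mean_norm_convex (ltW tau0) k0 Phi 0 (ltW lam0) lam1.
  rewrite scaler0 addr0 addrC subrK => /(_ erefl); rewrite -!/(N _) => h.
  apply: le_trans h _; have /andP[_] := Nb 0; rewrite normr0 add0r => N0.
  have : lam * N Phi <= lam * (1 + sg) by apply: ler_wpM2l; first exact: ltW.
  have : (1 - lam) * N 0 <= (1 - lam) * 2^-1 by rewrite ler_wpM2l.
  by move: lams; clear; lra.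
have -> : x t @@ (lam *: Phi) = lam * (x t @@ phi +
    tau / 2 * (x t @@ psi t - x t @@ psi s)).
  by rewrite /Phi !(dual_applyB, dual_applyD, dual_applyZ) mulrA.
move=> h8; have {}h8 : x t @@ phi + tau / 2 * (x t @@ psi t - x t @@ psi s) <=
    (1 + 2 * sg) * rho.
  by rewrite -(ler_pM2l lam0) [leRHS]mulrA lams mul1r.
have epse : eps = 16 * e by rewrite mulrC divfK.
have [{}h2 _] := ltr_normlP _ _ h2.
have [_ {}h3] := ltr_normlP _ _ h3.
have [{}h4 _] := ltr_normlP _ _ h4.
have [_ {}h5] := ltr_normlP _ _ h5.
have er : 0 < e * rho by rewrite mulr_gt0.
have ter : 0 < tau * (e * rho) by rewrite mulr_gt0.
move: h2 h3 h4 h5 h6 h8 er ter; rewrite epse /sg.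
move: (y @@ psi s) (y @@ psi t) (x t @@ psi s) (x t @@ psi t) => ys yt xs xt.
move: (x t @@ phi) (y @@ phi) => xphi yphi.
clear -tau0 => h2 h3 h4 h5 h6 h8 er ter.
have h9 : tau * (15 * (e * rho)) <= tau * (xt - xs).
  by apply: ler_wpM2l; [exact: ltW|lra].
by lra.
Qed.

End AsymptoticConvexity.

(** * Typical branches of the tree *)

Section BranchFilter.
Variable U : set_system nat.
Hypothesis UU : UltraFilter U.

(** The [k]-fold Fubini power of [U].  Its sets are the properties of typical
    branches of height [k], and limits along it are iterated limits over the
    successive terms; no subtrees have to be extracted. *)
Fixpoint branch (k : nat) : set_system (seq nat) :=
  if k is k'.+1 then
    (fun p : nat * seq nat => p.1 :: p.2) @ iterated_filter U (branch k')
  else principal_filter [::].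

Lemma branch_ultra k : UltraFilter (branch k).
Proof.
elim: k => [|k IHk]; first exact: principal_filter_ultra.
exact/fmap_ultra/iterated_filter_ultra.
Qed.
Local Instance branch_ultra_instance k : UltraFilter (branch k) := branch_ultra k.

Lemma branchS k (P : set (seq nat)) :
  branch k.+1 P = (\forall n \near U, \forall s \near branch k, P (n :: s)).
Proof. by []. Qed.

Lemma branchSS k (P : set (seq nat)) : branch k.+2 P =
  (\forall n \near U, \forall m \near U, \forall s \near branch k,
     P [:: n, m & s]).
Proof. by []. Qed.

Lemma branch_cat j k (P : set (seq nat)) :
  branch (j + k)%N P = (\forall s \near branch j, \forall t \near branch k, P (s ++ t)).
Proof.
elim: j P => [|j IHj] P.
  rewrite add0n; apply/propeqP; split; first by move=> h; exact/principal_filterP.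
  by move=> /principal_filterP.
rewrite addSn branchS [RHS]branchS; congr (nbhs U _).
by apply/funext => n; exact: IHj.
Qed.

Lemma branch_size k : \forall s \near branch k, size s = k.
Proof.
elim: k => [|k IHk]; first exact/principal_filterP.
suff : \forall n \near U, \forall s \near branch k, size (n :: s) = k.+1 by [].
by apply: filterE => n; apply: filterS IHk => s /= ->.
Qed.

Fixpoint even_terms (s : seq nat) : seq nat :=
  if s is x :: s' then x :: (if s' is _ :: s'' then even_terms s'' else [::])
  else [::].
Definition odd_terms (s : seq nat) : seq nat := even_terms (behead s).
Arguments odd_terms : simpl never.

Lemma odd_terms_cons2 x y s : odd_terms [:: x, y & s] = y :: odd_terms s.
Proof. by case: s. Qed.

Lemma even_terms_cat k s t : size s = k.*2 ->
  even_terms (s ++ t) = even_terms s ++ even_terms t.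
Proof. by elim: k s => [[]//|k IHk [|x [|y s]]//= [/IHk ->]]. Qed.

Lemma odd_terms_cat k s t : size s = k.*2 ->
  odd_terms (s ++ t) = odd_terms s ++ odd_terms t.
Proof.
elim: k s => [[]//|k IHk [|x [|y s]]//]; rewrite doubleS => -[/IHk sk].
have -> : [:: x, y & s] ++ t = [:: x, y & s ++ t] by [].
by rewrite !odd_terms_cons2 sk.
Qed.

Lemma size_even_terms k s : size s = k.*2 -> size (even_terms s) = k.
Proof. by elim: k s => [[]//|k IHk [|x [|y s]]//= [/IHk ->]]. Qed.

Lemma size_odd_terms k s : size s = k.*2 -> size (odd_terms s) = k.
Proof.
elim: k s => [[]//|k IHk [|x [|y s]]//]; rewrite doubleS => -[/IHk sk].
by rewrite odd_terms_cons2 /= sk.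
Qed.

Lemma branch_even_terms k (P : set (seq nat)) :
  branch k P -> \forall s \near branch k.*2, P (even_terms s).
Proof.
elim: k P => [|k IHk] P; first by move=> /principal_filterP ?; exact/principal_filterP.
rewrite branchS => Pn.
suff : \forall n \near U, \forall m \near U, \forall s \near branch k.*2,
    P (n :: even_terms s) by [].
by apply: filterS Pn => n /IHk Pn; apply: filterE.
Qed.

Lemma branch_odd_terms k (P : set (seq nat)) :
  branch k P -> \forall s \near branch k.*2, P (odd_terms s).
Proof.
elim: k P => [|k IHk] P; first by move=> /principal_filterP ?; exact/principal_filterP.
rewrite branchS => Pn.
suff : \forall n \near U, \forall m \near U, \forall s \near branch k.*2,
    P (odd_terms [:: n, m & s]) by [].
apply: filterE => n; apply: filterS Pn => m /IHk; apply: filterS => s.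
by rewrite odd_terms_cons2.
Qed.

(** At each level the even terms are chosen separately for the two sequences, and
    then one odd term that suits both. *)
Lemma branch_pair_same_odd_terms k (P Q : set (seq nat)) :
  branch k.*2 P -> branch k.*2 Q ->
  exists s t, [/\ P s, Q t, size s = k.*2, size t = k.*2 &
                  odd_terms s = odd_terms t].
Proof.
elim: k P Q => [|k IHk] P Q.
  by move=> /principal_filterP Ps /principal_filterP Qs; exists [::], [::].
rewrite doubleS !branchSS => Pn Qn.
have [n {}Pn] := filter_ex Pn; have [n' {}Qn] := filter_ex Qn.
have [m [{}Pn {}Qn]] := filter_ex (filterI Pn Qn).
have [s [t [Ps Qt ss st st']]] := IHk _ _ Pn Qn.
exists [:: n, m & s], [:: n', m & t]; split=> //=; rewrite ?ss ?st//.
by rewrite !odd_terms_cons2 st'.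
Qed.

Hypothesis U_infty : forall n : nat, \forall m \near U, (n < m)%N.

Lemma branch_fork k (P : set (seq nat)) : (0 < k)%N -> branch k.*2 P ->
  exists s t n m s' t', [/\ P s, P t,
    even_terms s = n :: s', even_terms t = m :: t' &
    [/\ n <> m, size s = k.*2, size t = k.*2 & odd_terms s = odd_terms t]].
Proof.
case: k => // k _; rewrite doubleS branchSS => Pn.
have [n Pn1] := filter_ex Pn.
have [n' [Pn2 nn']] := filter_ex (filterI Pn (U_infty n)).
have [m [{}Pn1 {}Pn2]] := filter_ex (filterI Pn1 Pn2).
have [s [t [Ps Qt ss st st']]] := branch_pair_same_odd_terms Pn1 Pn2.
exists [:: n, m & s], [:: n', m & t], n, n', (even_terms s), (even_terms t).
split=> //; split; rewrite /= ?ss ?st//; first by move=> nn; rewrite nn ltnn in nn'.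
by rewrite !odd_terms_cons2 st'.
Qed.

Lemma branch_heads_neq k : (0 < k)%N -> \forall s \near branch k.*2,
  exists n m s' t', [/\ even_terms s = n :: s', odd_terms s = m :: t' & n <> m].
Proof.
case: k => // k _; rewrite doubleS.
suff : \forall n \near U, \forall m \near U, \forall s \near branch k.*2,
    exists n' m' s' t', [/\ even_terms [:: n, m & s] = n' :: s',
      odd_terms [:: n, m & s] = m' :: t' & n' <> m'] by [].
apply: filterE => n; apply: filterS (U_infty n) => m nm; apply: filterE => s.
exists n, m, (even_terms s), (odd_terms s); rewrite odd_terms_cons2; split=> //.
by move=> mn; rewrite mn ltnn in nm.
Qed.

End BranchFilter.

(** * Limits of functionals along the tree *)

Section Jump.
Variables (R : realType) (E : normedModType R) (U : set_system nat).
Hypothesis UU : UltraFilter U.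

Definition branch_limit (phi : seq nat -> dual E) (L : seq nat -> nat -> dual E) :
  Prop := forall p k, weak_star_cvg (branch U k) (fun q => phi (p ++ q)) (L p k).

Lemma ex_branch_limit (phi : seq nat -> dual E) (M : R) :
  (forall s, `|phi s| <= M) ->
  exists2 L, branch_limit phi L & forall p k, `|L p k| <= M.
Proof.
move=> phiM.
have exL (pk : seq nat * nat) : exists psi : dual E, `|psi| <= M /\
    weak_star_cvg (branch U pk.2) (fun q => phi (pk.1 ++ q)) psi.
  have [|psi] := @ex_weak_star_limit R E _ (branch U pk.2)
    (fun q => phi (pk.1 ++ q)) M (branch_ultra UU pk.2).
    by move=> q; exact: phiM.
  by exists psi.
have [L LP] := choice exL.
by exists (fun p k => L (p, k)) => p k; have [] := LP (p, k).
Qed.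

Lemma branch_limit_cat phi L p j k : branch_limit phi L ->
  weak_star_cvg (branch U j) (fun q => L (p ++ q) k) (L p (j + k)%N).
Proof.
move=> phiL x.
have UJ := branch_ultra UU j; have UK := branch_ultra UU k.
have UJK := branch_ultra UU (j + k)%N.
apply/cvgrPdist_le => e e0.
have : \forall s \near branch U (j + k)%N, `|L p (j + k)%N @@ x - phi (p ++ s) @@ x| < e.
  by move: (phiL p (j + k)%N x) => /cvgrPdist_lt /(_ _ e0).
rewrite nearE branch_cat//; apply: filterS => q hq.
have lq : (L p (j + k)%N @@ x - phi (p ++ q ++ t) @@ x) @[t --> branch U k] -->
    L p (j + k)%N @@ x - L (p ++ q) k @@ x.
  apply: cvgB; first exact: cvg_cst.
  by under eq_fun do rewrite catA; exact: phiL.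
apply: (cvgr_to_le (cvg_norm lq)).
by apply: filterS hq => t /ltW.
Qed.

(** If all the limits along a tree of height [M] jumped by more than [eps], each
    level would lie one derived set deeper than the next one. *)
Lemma ex_small_jump (phi : seq nat -> dual E) L (eps : R) (M b : nat) :
  branch_limit phi L -> (forall p k, `|L p k| <= 1) ->
  szlenk_iter eps (dual_ball E) (ord_nat M) = set0 ->
  exists2 j, (j < M)%N &
    \forall p \near branch U ((M - j.+1) * b)%N, \forall v \near branch U b,
      `|L (p ++ v) (j * b)%N - L p (j.+1 * b)%N| <= eps.
Proof.
move=> phiL L1 sM; apply: contrapT => nojump.
have Bu := branch_ultra UU.
have deep j : (j <= M)%N -> \forall p \near branch U ((M - j) * b)%N,
    szlenk_iter eps (dual_ball E) (ord_nat j) (L p (j * b)%N).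
  elim: j => [|j IHj] jM; first by apply: filterE => p; exact: L1.
  have := IHj (ltnW jM).
  rewrite -(subnSK jM) mulSn addnC nearE branch_cat// => Hs.
  have /(ultra_not (Bu _)) nj : ~ \forall p \near branch U ((M - j.+1) * b)%N,
      \forall v \near branch U b,
      `|L (p ++ v) (j * b)%N - L p (j.+1 * b)%N| <= eps.
    by move=> h; apply: nojump; exists j.
  apply: filterS2 Hs nj => p Hv /(ultra_not (Bu _)) nv.
  have cv := @branch_limit_cat phi L p b (j * b)%N phiL.
  have jcl : ultraclosed (szlenk_iter eps (dual_ball E) (ord_nat j)).
    by apply: szlenk_iter_nat_ultraclosed; exact: ball_ultraclosed.
  have Lj := jcl _ _ _ _ (Bu b) Hv cv; rewrite -mulSn in Lj cv.
  apply: contrapT => /(not_szlenk_deriv_near (Bu b) Hv cv Lj) nd.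
  by have [v [nv' [_ ?]]] := filter_ex (filterI nv nd); exact: nv'.
have := deep M (leqnn _); rewrite subnn mul0n => /principal_filterP.
by rewrite sM.
Qed.

End Jump.

(** * Finite codimension in the bidual *)

Section FiniteExtension.
Variables (R : realType) (E : normedModType R).
Implicit Types (Y : set E) (g x y : E).

Definition norm_closed Y : Prop :=
  forall x, (forall eta : R, 0 < eta -> exists2 y, Y y & `|x - y| <= eta) -> Y x.

Definition subspace_set Y : Prop :=
  Y 0 /\ forall (a : R) x y, Y x -> Y y -> Y (a *: x + y).

Definition add_line g Y : set E := [set x | exists2 c : R, True & Y (x - c *: g)].

Lemma subspace_setZ Y (a : R) x : subspace_set Y -> Y x -> Y (a *: x).
Proof. by move=> [Y0 YD] Yx; rewrite -[_ *: _]addr0; exact: YD. Qed.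

Lemma add_line_subspace g Y : subspace_set Y -> subspace_set (add_line g Y).
Proof.
move=> [Y0 YD]; split; first by exists 0 => //; rewrite scale0r subr0.
move=> a x y [c _ Yx] [d _ Yy]; exists (a * c + d) => //.
have -> : a *: x + y - (a * c + d) *: g = a *: (x - c *: g) + (y - d *: g).
  by rewrite scalerBr scalerA scalerDl opprD addrACA.
exact: YD.
Qed.

(** The coefficient along [g] is controlled by the norm because a closed subspace
    stays at positive distance from [g]. *)
Lemma add_line_coefficient g Y : subspace_set Y -> norm_closed Y -> ~ Y g ->
  exists2 mu : R, 0 < mu &
    forall (c : R) x, Y (x - c *: g) -> `|c| * mu <= `|x|.
Proof.
move=> Ys Yc Yg.
have [mu mu0 gY] : exists2 mu : R, 0 < mu & forall y, Y y -> mu <= `|g - y|.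
  apply: contrapT => nmu; apply: Yg; apply: Yc => eta eta0.
  apply: contrapT => ny; apply: nmu; exists eta => // y Yy.
  by rewrite leNgt; apply/negP => lt; apply: ny; exists y => //; exact: ltW.
exists mu => // c x Yx; have [->|c0] := eqVneq c 0; first by rewrite normr0 mul0r.
have := gY _ (subspace_setZ (- c^-1) Ys Yx).
have -> : g - - c^-1 *: (x - c *: g) = c^-1 *: x.
  by rewrite scaleNr opprK scalerBr scalerA mulVf// scale1r addrC subrK.
by rewrite normrZ normfV ler_pdivlMl ?normr_gt0.
Qed.

Lemma add_line_closed g Y :
  subspace_set Y -> norm_closed Y -> norm_closed (add_line g Y).
Proof.
move=> Ys Yc x xY; have [Yg|Yg] := pselect (Y g).
  exists 0 => //; rewrite scale0r subr0; apply: Yc => eta /xY[y [c _ Yy] xy].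
  exists y => //; rewrite -[y](subrK (c *: g)) addrC.
  exact: Ys.2.
have [mu mu0 mule] := add_line_coefficient Ys Yc Yg.
have exc (k : nat) : exists c : R, exists2 y, Y (y - c *: g) & `|x - y| <= k.+1%:R^-1.
  have [|y [c _ Yy] xy] := xY k.+1%:R^-1; first by rewrite invr_gt0.
  by exists c, y.
have [c cP] := choice exc.
have [U [UU Uinf]] := ex_ultra_infty.
have cb k : `|c k| <= (`|x| + 1) / mu.
  have [y Yy xy] := cP k; rewrite ler_pdivlMr//.
  apply: le_trans (mule _ _ Yy) _; rewrite -[y](subKr x).
  apply: le_trans (ler_normB _ _) _; rewrite lerD2l.
  by apply: le_trans xy _; rewrite invf_le1 ?ler1n.
have [d cd] := ultra_cvg_bounded UU (filterE _ cb).
exists d => //; apply: Yc => eta eta0.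
pose e := eta / (2 * (`|g| + 1)).
have g1 : 0 < `|g| + 1 by rewrite ltr_wpDl.
have e0 : 0 < e by rewrite divr_gt0// mulr_gt0.
have cde : \forall k \near U, `|d - c k| < e by move/cvgrPdist_lt : cd; exact.
have [k [dk kN]] := filter_ex (filterI cde (Uinf (Num.bound (2 / eta)))).
have [y Yy xy] := cP k; exists (y - c k *: g) => //.
have -> : x - d *: g - (y - c k *: g) = (x - y) - (d - c k) *: g.
  by rewrite scalerBl !opprB [LHS]addrACA [RHS]addrACA (addrC (- y)).
apply: le_trans (ler_normB _ _) _; rewrite [eta]splitr; apply: lerD.
  apply: le_trans xy _; rewrite invf_ple ?posrE ?divr_gt0// invf_div.
  apply/ltW/(lt_le_trans (archi_boundP _)); first by rewrite divr_ge0 ?ltW.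
  by rewrite ler_nat ltnW// ltnS ltnW.
rewrite normrZ; apply: (@le_trans _ _ (e * (`|g| + 1))).
  by apply: ler_pM => //; [exact: ltW|rewrite lerDl].
by rewrite /e invfM mulrA divfK// gt_eqF.
Qed.

(** Total boundedness of the bounded subsets of the quotient of [Y] by [Y0],
    expressed along ultrafilters. *)
Definition precompact_modulo (Y0 Y : set E) : Prop :=
  forall (T : Type) (F : set_system T) (xi : T -> E) (M eta : R),
    UltraFilter F -> (forall t, Y (xi t)) -> (forall t, `|xi t| <= M) -> 0 < eta ->
    exists zeta, \forall t \near F, exists2 z, Y0 z & `|xi t - zeta - z| <= eta.

Lemma precompact_modulo_add_line g (Y0 Y : set E) :
  subspace_set Y -> norm_closed Y ->
  precompact_modulo Y0 Y -> precompact_modulo Y0 (add_line g Y).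
Proof.
move=> Ys Yc Ypc T F xi M eta FU xiY xiM eta0.
have [Yg|Yg] := pselect (Y g).
  apply: (Ypc _ _ _ M) => // t; have [c _ Yx] := xiY t.
  by rewrite -[xi t](subrK (c *: g)) addrC; exact: Ys.2.
have [mu mu0 mule] := add_line_coefficient Ys Yc Yg.
have exc t : exists c : R, Y (xi t - c *: g) by have [c _ ?] := xiY t; exists c.
have [c cP] := choice exc.
have cb t : `|c t| <= M / mu.
  by rewrite ler_pdivlMr//; apply: le_trans (mule _ _ (cP t)) _.
have [d cd] := ultra_cvg_bounded FU (filterE _ cb).
have eta2 : 0 < eta / 2 by rewrite divr_gt0.
have xib t : `|xi t - c t *: g| <= M + M / mu * `|g|.
  apply: le_trans (ler_normB _ _) _; apply: lerD => //.
  by rewrite normrZ ler_wpM2r.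
have [zeta zP] := Ypc _ _ _ _ _ FU cP xib eta2.
exists (zeta + d *: g).
pose e := eta / (2 * (`|g| + 1)).
have g1 : 0 < `|g| + 1 by rewrite ltr_wpDl.
have e0 : 0 < e by rewrite divr_gt0// mulr_gt0.
have cde : \forall t \near F, `|d - c t| < e by move/cvgrPdist_lt : cd; exact.
apply: filterS2 zP cde => t [z Yz xz] dct; exists z => //.
have -> : xi t - (zeta + d *: g) - z =
    (xi t - c t *: g - zeta - z) - (d - c t) *: g.
  rewrite -{1}[xi t](subrK (c t *: g)) opprD addrACA scalerBl opprB.
  by rewrite [RHS]addrAC.
apply: le_trans (ler_normB _ _) _; rewrite [eta]splitr; apply: lerD => //.
rewrite normrZ; apply: (@le_trans _ _ (e * (`|g| + 1))).
  by apply: ler_pM => //; [exact: ltW|rewrite lerDl].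
by rewrite /e invfM mulrA divfK// gt_eqF.
Qed.

Lemma precompact_modulo_foldr (Y0 : set E) (s : seq E) :
  subspace_set Y0 -> norm_closed Y0 ->
  let Y := foldr add_line Y0 s in
  [/\ subspace_set Y, norm_closed Y & precompact_modulo Y0 Y].
Proof.
move=> Y0s Y0c; elim: s => [|g s [IH1 IH2 IH3]] /=.
  split=> // T F xi M eta FU xiY _ eta0; exists 0; apply: filterE => t.
  by exists (xi t) => //; rewrite subr0 subrr normr0 ltW.
split; first exact: add_line_subspace.
  exact: add_line_closed.
exact: precompact_modulo_add_line.
Qed.

Lemma foldr_add_line_sum (Y0 : set E) (I : Type) (s : seq I) (c : I -> R)
    (g : I -> E) z : Y0 z ->
  foldr add_line Y0 (map g s) (z + \sum_(i <- s) c i *: g i).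
Proof.
move=> Yz; elim: s => [|i s IHs] /=; first by rewrite big_nil addr0.
by exists (c i) => //; rewrite big_cons [X in z + X]addrC addrA addrK.
Qed.

End FiniteExtension.

Section QuasiReflexive.
Variables (R : realType) (X : completeNormedModType R).

Lemma bidual_embB (x y : X) : bidual_emb (x - y) = bidual_emb x - bidual_emb y.
Proof. by apply: dualP => f /=; exact: linearB. Qed.

Lemma bidual_range_subspace : subspace_set (range (@bidual_emb R X)).
Proof.
split; first by exists 0 => //; apply: dualP => f /=; exact: linear0.
move=> a _ _ [x _ <-] [y _ <-]; exists (a *: x + y) => //.
by apply: dualP => f /=; rewrite linearP.
Qed.

Lemma bidual_range_norm_closed : norm_closed (range (@bidual_emb R X)).
Proof.
move=> xi xiX.
have exz (k : nat) : exists z : X, `|xi - bidual_emb z| <= k.+1%:R^-1.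
  have [|_ [z _ <-] xz] := xiX k.+1%:R^-1; first by rewrite invr_gt0.
  by exists z.
have [z zP] := choice exz.
have small (eta : R) : 0 < eta -> \forall k \near \oo, `|xi - bidual_emb (z k)| < eta.
  move=> eta0; exists (Num.bound eta^-1) => // k /= kN.
  apply: le_lt_trans (zP k) _; rewrite invf_plt ?posrE//.
  apply: (lt_le_trans (archi_boundP _)); first by rewrite invr_ge0 ltW.
  by rewrite ler_nat; apply: leq_trans kN _.
have cz : cauchy (z @ \oo).
  apply/cauchyP => eta eta0; have eta2 : 0 < eta / 2 by rewrite divr_gt0.
  have [N _ NP] := small _ eta2; exists (z N).
  exists N => // k /= kN; rewrite -ball_normE /ball_ /=.
  rewrite -bidual_emb_norm bidual_embB.
  rewrite -(subrKA xi) -opprB addrC [eta]splitr.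
  apply: le_lt_trans (ler_normD _ _) _; rewrite normrN.
  by rewrite ltrD// NP/=.
have /cvg_ex[l /cvgrPdist_lt zl] : cvg (z @ \oo) by exact/cauchy_cvgP.
exists l => //; apply/eqP; rewrite -subr_eq0 -normr_le0.
apply/ler_addgt0Pr => eta eta0; have eta2 : 0 < eta / 2 by rewrite divr_gt0.
have [k [xk lk]] := filter_ex (filterI (small _ eta2) (zl _ eta2)).
rewrite add0r -(subrKA (bidual_emb (z k))) -bidual_embB [eta]splitr.
apply: le_trans (ler_normD _ _) _; apply: lerD; last by rewrite distrC ltW.
by rewrite bidual_emb_norm ltW.
Qed.

Lemma quasi_reflexive_precompact : quasi_reflexive X ->
  precompact_modulo (range (@bidual_emb R X)) setT.
Proof.
move=> [n [e eP]].
have [_ _ H] := precompact_modulo_foldr [seq lrepr (e i) | i <- enum 'I_n]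
  bidual_range_subspace bidual_range_norm_closed.
move=> T F xi M eta FU _; apply: (H _ _ _ M) => t.
have [c xic] := eP (lpi (@bidual_range_closed R X) (xi t)).
pose s := \sum_(i < n) c i *: lrepr (e i).
have : lpi (@bidual_range_closed R X) (xi t) = lpi _ s.
  rewrite xic /s; elim/big_ind2 : _ => [|x u y v -> ->|i _].
  - by apply: (addrI (lpi (@bidual_range_closed R X) 0)); rewrite -lpiD !addr0.
  - by rewrite lpiD.
  - by rewrite lpiZ lreprK.
move=> /lpi_eqP /asboolP[z xisz].
have -> : xi t = bidual_emb z + s by rewrite -xisz subrK.
by rewrite /s -big_enum; apply: foldr_add_line_sum; exists z.
Qed.

End QuasiReflexive.

(** * The paired tree *)

Section TypicalBlocks.
Variables (U : set_system nat).
Hypothesis UU : UltraFilter U.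

Lemma branch_cvg_even_terms (R : realType) (u : seq nat -> R) (l : R) k :
  u s @[s --> branch U k] --> l -> u (even_terms s) @[s --> branch U k.*2] --> l.
Proof.
have Uk := branch_ultra UU k; have Ukk := branch_ultra UU k.*2.
move=> /cvgrPdist_lt ul; apply/cvgrPdist_lt => e e0.
exact: (branch_even_terms UU (ul e e0)).
Qed.

Lemma branch_cvg_odd_terms (R : realType) (u : seq nat -> R) (l : R) k :
  u s @[s --> branch U k] --> l -> u (odd_terms s) @[s --> branch U k.*2] --> l.
Proof.
have Uk := branch_ultra UU k; have Ukk := branch_ultra UU k.*2.
move=> /cvgrPdist_lt ul; apply/cvgrPdist_lt => e e0.
exact: (branch_odd_terms UU (ul e e0)).
Qed.

Lemma branch_take i j k (Q : seq nat -> seq nat -> Prop) :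
  (\forall p \near branch U i, \forall v \near branch U j, Q p (p ++ v)) ->
  \forall s \near branch U (i + j + k)%N, Q (take i s) (take (i + j) s).
Proof.
have Ui := branch_ultra UU i; have Uj := branch_ultra UU j.
have Uk := branch_ultra UU k.
move=> Qpv; rewrite -addnA nearE branch_cat//.
apply: filterS2 (branch_size UU i) Qpv => p pi Qv; rewrite nearE branch_cat//.
apply: filterS2 (branch_size UU j) Qv => v vj Qpv; apply: filterE => t.
by rewrite -pi -vj (take_size_cat (v ++ t) erefl) catA take_size_cat ?size_cat.
Qed.

Lemma telescope_block (R : realType) (u : nat -> R) (M m : nat) (r : R) :
  (m < M)%N -> (forall i, (i < M)%N -> u i.+1 - u i <= r) ->
  u M - u 0%N <= u m.+1 - u m + (M%:R - 1) * r.
Proof.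
move=> mM ur.
have H i n : (i + n <= M)%N -> u (i + n)%N - u i <= n%:R * r.
  elim: n => [|n IHn] inM; first by rewrite addn0 subrr mul0r.
  rewrite addnS in inM *; have := IHn (ltnW inM); have := ur _ inM.
  by rewrite -natr1 mulrDl mul1r; move: (n%:R * r) => x; clear; lra.
have := H 0%N m (ltnW mM); have := H m.+1 (M - m.+1)%N.
rewrite subnKC// add0n => /(_ (leqnn _)).
have -> : M%:R - 1 = m%:R + (M - m.+1)%:R :> R.
  by rewrite -[in LHS](subnKC mM) natrD -natr1; lra.
rewrite mulrDl; move: (m%:R * r) ((M - m.+1)%:R * r) => x y; clear; lra.
Qed.

End TypicalBlocks.

Lemma subr_common (V : zmodType) (x y z : V) : (x - z) - (y - z) = x - y.
Proof. by rewrite opprB subrKA. Qed.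

Section PairedTree.
Variables (R : realType) (X : completeNormedModType R) (U : set_system nat).
Hypotheses (UU : UltraFilter U)
  (U_infty : forall n : nat, \forall m \near U, (n < m)%N).
Variables (f : seq nat -> X) (B : R).
Hypothesis f_bounded : forall s, `|f s| <= B.

(** Two branches run in parallel by interleaving their terms.  An increment of
    [paired] is a difference of increments of [f] at two independent nodes of the
    same level, so that the classes modulo [X] of their limits nearly cancel. *)
Definition paired (s : seq nat) : X := f (even_terms s) - f (odd_terms s).

Lemma paired_bounded s : `|paired s| <= B + B.
Proof. by apply: le_trans (ler_normB _ _) _; exact: lerD. Qed.

(** The weak star limit of the increments of [paired] from a node is, modulo [X],
    the difference of the limits [xi] of [f] below the two underlying nodes.  The
    family [xi] is bounded and the bidual is finite dimensional modulo [X], hence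
    both limits are close to one [zeta] modulo [X] for typical nodes. *)
Lemma paired_limit_near_space (l h : nat) (eta : R) :
  quasi_reflexive X -> 0 < eta ->
  \forall w \near branch U l.*2, exists z : X, forall x : dual (dual X),
    weak_star_cvg (branch U h.*2)
      (fun v => bidual_emb (paired (w ++ v) - paired w)) x ->
    `|x - bidual_emb z| <= eta.
Proof.
move=> Xqr eta0; have eta2 : 0 < eta / 2 by rewrite divr_gt0.
have Ul := branch_ultra UU l; have Uh := branch_ultra UU h.
have Ull := branch_ultra UU l.*2; have Uhh := branch_ultra UU h.*2.
have exxi p : exists psi : dual (dual X), `|psi| <= B /\
    weak_star_cvg (branch U h) (fun v => bidual_emb (f (p ++ v))) psi.
  have [v|psi] := @ex_weak_star_limit R (dual X) _ (branch U h)
    (fun v => bidual_emb (f (p ++ v))) B Uh; first by rewrite bidual_emb_norm.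
  by exists psi.
have [xi xiP] := choice exxi.
have [zeta zetaP] := quasi_reflexive_precompact Xqr Ul
  (fun t => I : setT (xi t)) (fun t => (xiP t).1) eta2.
apply: filterS (filterI (branch_size UU l.*2) (filterI
  (branch_even_terms UU zetaP) (branch_odd_terms UU zetaP))) => w [wl [[_ [ze _ <-] hze] [_ [zo _ <-] hzo]]].
exists (ze - zo - paired w) => x cx.
have -> : x = xi (even_terms w) - xi (odd_terms w) - bidual_emb (paired w).
  apply: dualP => phi.
  have H : (bidual_emb (paired (w ++ v) - paired w) @@ phi) @[v --> branch U h.*2]
      --> xi (even_terms w) @@ phi - xi (odd_terms w) @@ phi - phi @@ paired w.
    have -> : (fun v => bidual_emb (paired (w ++ v) - paired w) @@ phi) =
        (fun v => phi @@ f (even_terms w ++ even_terms v) -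
                  phi @@ f (odd_terms w ++ odd_terms v) - phi @@ paired w).
      apply/funext => v; rewrite /= dual_applyB; congr (_ - _).
      by rewrite /paired dual_applyB (even_terms_cat _ wl) (odd_terms_cat _ wl).
    apply: cvgB; last exact: cvg_cst.
    apply: cvgB.
      exact: (branch_cvg_even_terms UU ((xiP (even_terms w)).2 phi)).
    exact: (branch_cvg_odd_terms UU ((xiP (odd_terms w)).2 phi)).
  exact: (cvg_unique _ (cx phi) H).
have -> : xi (even_terms w) - xi (odd_terms w) - bidual_emb (paired w) -
    bidual_emb (ze - zo - paired w) =
    (xi (even_terms w) - zeta - bidual_emb ze) -
    (xi (odd_terms w) - zeta - bidual_emb zo).
  rewrite !bidual_embB subr_common opprD addrACA -opprD.
  rewrite [in RHS](addrAC (xi (even_terms w))).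
  by rewrite [in RHS](addrAC (xi (odd_terms w))) subr_common.
apply: le_trans (ler_normB _ _) _; rewrite [eta]splitr; exact: lerD.
Qed.

End PairedTree.

(** * Contraction of long increments *)

Section Arithmetic.
Variable R : realFieldType.
Implicit Types theta M r delta u : R.

Lemma limit_functional_arith theta M r delta u u' :
  (1 - theta) * (M * r) - (M - 1) * r <= u -> u - u' <= delta / 8 * (2 * r) ->
  (1 - theta * M - delta / 4) * r <= u'.
Proof. lra. Qed.

(** A quarter of [delta] is lost to [theta], one to the jump of the functionals, and
    one to the passage from [psi] to an element of [C] through the point [z] of
    [X]; the last quarter contradicts asymptotic convexity. *)
Lemma contraction_arith theta M r delta u1 u2 u3 u4 :
  0 < delta -> 0 < r -> theta * M <= delta / 4 ->
  (1 - theta * M - delta / 4) * r <= u1 -> u1 - u2 <= delta * r / 12 ->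
  - (u3 - u4) <= delta * r / 12 -> u2 - u4 < delta * r / 12 ->
  ~ u3 <= (1 - delta) * r.
Proof.
move=> delta0 r0 thetaM h1 h2 h3 h4 h5.
have h6 : theta * M * r <= delta / 4 * r by rewrite ler_wpM2r// ltW.
have h7 : 0 < delta * r by rewrite mulr_gt0.
lra.
Qed.

End Arithmetic.

Section Contraction.
Variables (R : realType) (X : completeNormedModType R) (U : set_system nat).
Hypotheses (UU : UltraFilter U)
  (U_infty : forall n : nat, \forall m \near U, (n < m)%N).
Variables (f : seq nat -> X) (B a eps delta : R) (N : nat) (C : set (dual X)).
Hypotheses (f_bounded : forall s, `|f s| <= B)
  (f_fork : forall s n t m t', n <> m -> size t = size t' ->
    (size s + (size t).+1 <= N)%N ->
    2 * a * (size t).+1%:R <= `|f (s ++ n :: t) - f (s ++ m :: t')|)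
  (C_le1 : forall phi, C phi -> `|phi| <= 1)
  (C_half : forall phi, `|phi| <= 2^-1 -> C phi)
  (C_convex : asymptotically_convex C eps delta).

Local Notation G := (paired f).

(** Typical increments over [h] levels of both branches are measured by the norm
    [sup_C].  Levels of [paired] are doubled because of the interleaving. *)
Definition increments_le (h : nat) (r : R) : Prop :=
  forall l, (l + h <= N)%N ->
  \forall w \near branch U l.*2, \forall v \near branch U h.*2,
    forall phi, C phi -> phi @@ (G (w ++ v) - G w) <= r.

Lemma C_norm_le (x : X) (r : R) :
  (forall phi, C phi -> phi @@ x <= r) -> `|x| <= 2 * r.
Proof.
move=> xr; have [phi [phi1 phix]] := hahn_banach_norming x.
have : C (2^-1 *: phi).
  by apply: C_half; rewrite normrZ ger0_norm ?invr_ge0// ler_piMr ?invr_ge0.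
move=> /xr; have -> : (2^-1 *: phi) @@ x = 2^-1 * `|x| by rewrite -phix.
by rewrite ler_pdivrMl.
Qed.

(** If most increments were close to [x], so would be two of them with the same
    second branch and with first branches that separate at [w]; their difference
    is a difference of values of [f] at two nodes at distance [2 * h]. *)
Lemma paired_increments_apart (l h : nat) (w : seq nat) (x : dual (dual X))
    (rho : R) : (0 < h)%N -> (l + h <= N)%N -> size w = l.*2 ->
  rho < a * h%:R ->
  \forall v \near branch U h.*2, rho < `|bidual_emb (G (w ++ v) - G w) - x|.
Proof.
move=> h0 lhN wl rhoa; have Uhh := branch_ultra UU h.*2.
apply: contrapT => /(ultra_not Uhh) near_x.
have [s [t [n [m [s' [t' [xs xt es et [nm ss st ost]]]]]]]] :=
  branch_fork UU U_infty h0 near_x.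
have {}xs : `|bidual_emb (G (w ++ s) - G w) - x| <= rho.
  by rewrite leNgt; apply/negP; exact: xs.
have {}xt : `|bidual_emb (G (w ++ t) - G w) - x| <= rho.
  by rewrite leNgt; apply/negP; exact: xt.
have s'h : (size s').+1 = h by have := size_even_terms ss; rewrite es.
have t'h : (size t').+1 = h by have := size_even_terms st; rewrite et.
have st' : size s' = size t' by apply: succn_inj; rewrite s'h t'h.
have := f_fork nm st'; rewrite s'h => /(_ (even_terms w)).
rewrite (size_even_terms wl) => /(_ lhN).
have -> : f (even_terms w ++ n :: s') - f (even_terms w ++ m :: t') =
    (G (w ++ s) - G w) - (G (w ++ t) - G w).
  rewrite [RHS]subr_common /G /paired !(even_terms_cat _ wl).
  by rewrite !(odd_terms_cat _ wl) es et ost subr_common.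
rewrite -bidual_emb_norm bidual_embB => far.
have := ler_normB (bidual_emb (G (w ++ s) - G w) - x)
  (bidual_emb (G (w ++ t) - G w) - x).
rewrite subr_common => near.
have : 2 * (a * h%:R) <= 2 * rho.
  rewrite mulrA (mulr_natl rho 2) mulr2n; apply: le_trans far (le_trans near _).
  exact: (lerD xs xt).
by rewrite ler_pM2l// leNgt rhoa.
Qed.

(** The total increment is the sum of those over [M] blocks, the other [M - 1] of
    which are at most [r]. *)
Lemma block_extremal (w : seq nat) (M h : nat) (phi : seq nat -> dual X)
    (r total : R) : (forall s, C (phi s)) ->
  (forall m, (m < M)%N -> \forall p \near branch U (m * h.*2)%N,
     \forall v \near branch U h.*2,
     forall phi, C phi -> phi @@ (G (w ++ p ++ v) - G (w ++ p)) <= r) ->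
  (\forall s \near branch U (M * h.*2)%N, total <= phi s @@ (G (w ++ s) - G w)) ->
  forall m, (m < M)%N -> \forall p \near branch U (m * h.*2)%N,
    \forall v \near branch U h.*2,
    \forall q \near branch U ((M - m.+1) * h.*2)%N,
    total - (M%:R - 1) * r <=
    phi (p ++ v ++ q) @@ (G (w ++ p ++ v) - G (w ++ p)).
Proof.
move=> Cphi blocks tot m mM; set b := h.*2.
have Bu := branch_ultra UU.
have lenE i : (i < M)%N -> (i * b + b + (M - i.+1) * b = M * b)%N.
  by move=> iM; rewrite [X in (X + _)%N]addnC -mulSn -mulnDl subnKC.
have all_blocks : \forall s \near branch U (M * b)%N, forall i, (i < M)%N ->
    forall phi, C phi ->
    phi @@ (G (w ++ take (i.+1 * b) s) - G (w ++ take (i * b) s)) <= r.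
  apply: filter_forall_lt => i iM; rewrite -(lenE i iM) mulSn (addnC b).
  exact: (branch_take UU ((M - i.+1) * b) (Q := fun p p' =>
    forall phi, C phi -> phi @@ (G (w ++ p') - G (w ++ p)) <= r) (blocks i iM)).
have : \forall s \near branch U (M * b)%N, total - (M%:R - 1) * r <=
    phi s @@ (G (w ++ take (m.+1 * b) s) - G (w ++ take (m * b) s)).
  apply: filterS (filterI (branch_size UU (M * b)) (filterI all_blocks tot)).
  move=> s [sM [blk tots]].
  pose u i := phi s @@ G (w ++ take (i * b) s).
  have := telescope_block (u := u) (r := r) mM.
  rewrite /u mul0n take0 cats0 -sM take_size -!dual_applyB => H.
  rewrite lerBlDr; apply: le_trans tots (H _) => i iM.
  by rewrite -dual_applyB; exact: blk.
rewrite -(lenE m mM) -addnA nearE branch_cat//.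
apply: filterS2 (branch_size UU (m * b)) => p pm; rewrite nearE branch_cat//.
apply: filterS2 (branch_size UU b) => v vb; apply: filterS => q.
rewrite mulSn (addnC b) -pm -{1}vb (take_size_cat (v ++ q) erefl).
by rewrite catA take_size_cat ?size_cat// -catA.
Qed.
(** Cutting a long increment into [M] blocks gives the factor [M]; the gain
    [1 - theta] comes from a contradiction.  If long increments were nearly
    [M * r], consider functionals [phi] norming them and the limits [L] of these
    along the tree.  At some level these limits jump little, so that at a node [p]
    the limit functional [psi] is nearly extremal for all typical increments [y]
    over the next block, hence for their weak star limit [x].  As [x] is almost an
    element [z] of [X], and [psi] is a limit of elements of [C] pointwise on [X],
    some element of [C] is nearly extremal at [x], against asymptotic
    convexity. *)
Lemma increments_contract (M h : nat) (r theta : R) :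
  quasi_reflexive X -> 0 < delta -> (0 < h)%N -> 0 < r ->
  eps * r < a * h%:R -> theta * M%:R <= delta / 4 ->
  szlenk_iter (delta / 8) (dual_ball X) (ord_nat M) = set0 ->
  increments_le h r -> increments_le (M * h) ((1 - theta) * (M%:R * r)).
Proof.
move=> Xqr delta0 h0 r0 epsr thetaM sM inc l lMhN.
have Bu := branch_ultra UU.
apply: contrapT => /(ultra_not (Bu _)) big.
set b := h.*2; pose eta := delta * r / 12.
have eta0 : 0 < eta by rewrite divr_gt0// mulr_gt0.
have mhb m : (m * b = (m * h).*2)%N by rewrite /b -doubleMr.
(* the root from which the long increment is followed *)
have [w [[wl wbig] [winc wlim]]] : exists w, (size w = l.*2 /\
    ~ \forall v \near branch U (M * h).*2,
        forall phi, C phi -> phi @@ (G (w ++ v) - G w) <= (1 - theta) * (M%:R * r)) /\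
    ((forall m, (m < M)%N -> \forall p \near branch U (m * b)%N,
      \forall v \near branch U b, forall phi, C phi ->
        phi @@ (G (w ++ p ++ v) - G (w ++ p)) <= r) /\
    (forall m, (m < M)%N -> \forall p \near branch U (m * b)%N,
      exists z : X, forall x : dual (dual X), weak_star_cvg (branch U b)
        (fun v => bidual_emb (G ((w ++ p) ++ v) - G (w ++ p))) x ->
        `|x - bidual_emb z| <= eta)).
  apply: (@filter_ex _ (branch U l.*2)).
  apply: filterI; first exact: (filterI (branch_size UU l.*2) big).
  apply: filterI; apply: filter_forall_lt => m mM.
    have : (l + m * h + h <= N)%N.
      by apply: leq_trans lMhN; rewrite -addnA leq_add2l -mulSnr leq_mul2r mM orbT.
    move=> /inc; rewrite doubleD nearE branch_cat// -mhb.
    apply: filterS => s; apply: filterS => p; apply: filterS => v.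
    by rewrite catA.
  have := paired_limit_near_space UU f_bounded (l + m * h) h Xqr eta0.
  by rewrite doubleD nearE branch_cat// -mhb.
have {}wbig : \forall v \near branch U (M * b)%N, exists2 phi, C phi &
    (1 - theta) * (M%:R * r) < phi @@ (G (w ++ v) - G w).
  rewrite mhb; apply: filterS (ultra_not (Bu _) wbig) => v nv.
  apply: contrapT => nex; apply: nv => phi Cphi.
  by rewrite leNgt; apply/negP => lt; apply: nex; exists phi.
have C0 : C 0 by apply: C_half; rewrite normr0 invr_ge0.
have exphi v : exists phi, C phi /\ ((exists2 phi, C phi &
    (1 - theta) * (M%:R * r) < phi @@ (G (w ++ v) - G w)) ->
    (1 - theta) * (M%:R * r) < phi @@ (G (w ++ v) - G w)).
  have [[phi Cphi h1]|nex] := pselect (exists2 phi, C phi &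
    (1 - theta) * (M%:R * r) < phi @@ (G (w ++ v) - G w)); first by exists phi.
  by exists 0.
have [phi phiP] := choice exphi.
have Cphi v : C (phi v) by case: (phiP v).
have phi1 v : `|phi v| <= 1 by exact: C_le1.
have {wbig} wtot : \forall v \near branch U (M * b)%N,
    (1 - theta) * (M%:R * r) <= phi v @@ (G (w ++ v) - G w).
  by apply: filterS wbig => v /(phiP v).2 /ltW.
have [L phiL L1] := ex_branch_limit UU phi1.
have [j jM jump] := ex_small_jump UU b phiL L1 sM.
set m := (M - j.+1)%N in jump *.
have mM : (m < M)%N by rewrite ltn_subrL (leq_ltn_trans _ jM).
have jm : (M - m.+1)%N = j by rewrite /m subnSK// subKn// ltnW.
have := block_extremal Cphi winc wtot mM; rewrite -/b jm => ext.
have [p [pm [[pjump pext] [pinc plim]]]] := filter_ex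
  (filterI (branch_size UU (m * b)%N)
  (filterI (filterI jump ext) (filterI (winc m mM) (wlim m mM)))).
pose y v := G ((w ++ p) ++ v) - G (w ++ p).
have yE v : G (w ++ p ++ v) - G (w ++ p) = y v by rewrite catA.
have yr : \forall v \near branch U b, forall phi, C phi -> phi @@ y v <= r.
  by apply: filterS pinc => v; rewrite yE.
set psi := L p (j.+1 * b)%N in pjump.
have psiy : \forall v \near branch U b,
    (1 - theta * M%:R - delta / 4) * r <= psi @@ y v.
  apply: filterS (filterI pjump (filterI pext yr)) => v [vjump [vext vr]].
  have Lv : (1 - theta) * (M%:R * r) - (M%:R - 1) * r <= L (p ++ v) (j * b)%N @@ y v.
    apply: (cvgr_to_ge (phiL (p ++ v) (j * b)%N (y v))).
    by apply: filterS vext => q; rewrite yE catA.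
  have : `|(L (p ++ v) (j * b)%N - psi) @@ y v| <= delta / 8 * (2 * r).
    apply: le_trans (dual_apply_le _ vjump) _.
    by apply: ler_wpM2l; [rewrite divr_ge0// ltW|exact: C_norm_le].
  move=> /ler_normlP[_].
  have -> : (L (p ++ v) (j * b)%N - psi) @@ y v =
    L (p ++ v) (j * b)%N @@ y v - psi @@ y v by [].
  exact: limit_functional_arith.
have yB v : `|bidual_emb (y v)| <= (B + B) + (B + B).
  rewrite bidual_emb_norm; apply: le_trans (ler_normB _ _) _.
  by apply: lerD; exact: paired_bounded.
have [x _ cx] := ex_weak_star_limit (Bu b) yB.
have [z zx] := plim; have {}zx := zx x cx.
have xpsi : (1 - theta * M%:R - delta / 4) * r <= x @@ psi.
  exact: (cvgr_to_ge (cx psi) psiy).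
have near_z : \forall q \near branch U (j.+1 * b)%N,
    `|psi @@ z - phi (p ++ q) @@ z| < eta.
  have Bj := Bu (j.+1 * b)%N.
  by move: (phiL p (j.+1 * b)%N z) => /cvgrPdist_lt /(_ _ eta0).
have [q /ltr_normlP[_ qz]] := filter_ex near_z.
have xz (chi : dual X) : `|chi| <= 1 -> `|x @@ chi - chi @@ z| <= eta.
  move=> chi1; apply: le_trans (dual_apply_le chi zx) _.
  by rewrite ler_piMr// ltW.
have /ler_normlP[_ h1] := xz psi (L1 _ _).
have /ler_normlP[h2 _] := xz (phi (p ++ q)) (phi1 _).
have wp : size (w ++ p) = (l + m * h).*2 by rewrite size_cat wl pm mhb doubleD.
have mhN : (l + m * h + h <= N)%N.
  by apply: leq_trans lMhN; rewrite -addnA leq_add2l -mulSnr leq_mul2r mM orbT.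
have apart := paired_increments_apart x h0 mhN wp epsr.
have := @C_convex _ _ (fun v => bidual_emb (y v)) x r (Bu b) r0 yr cx apart
  _ (Cphi (p ++ q)).
exact: contraction_arith delta0 r0 thetaM xpsi h1 h2 qz.
Qed.

End Contraction.

(** * Embeddings of trees *)

Lemma common_prefix_fork s n t m t' :
  n <> m -> common_prefix (s ++ n :: t) (s ++ m :: t') = s.
Proof.
move=> nm; elim: s => [|x s IHs] /=; first by case: eqP.
by rewrite eqxx IHs.
Qed.

Lemma common_prefix_cat s t : common_prefix (s ++ t) s = s.
Proof. by elim: s => [|x s IHs] /=; [case: t|rewrite eqxx IHs]. Qed.

Section Embedding.
Variables (R : realType) (X : completeNormedModType R) (N : nat).
Variables (g : tree N -> X) (a b : R).
Hypothesis g_embeds : forall s t,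
  a * tree_dist R s t <= `|g s - g t| <= b * tree_dist R s t.

Definition extend_by0 (s : seq nat) : X := oapp g 0 (insub s : option (tree N)).

Lemma extend_by0E (t : tree N) : extend_by0 (val t) = g t.
Proof. by rewrite /extend_by0 valK. Qed.

Lemma extend_by0_distance s t : (size s <= N)%N -> (size t <= N)%N ->
  a * ((size s)%:R + (size t)%:R - 2 * (size (common_prefix s t))%:R) <=
  `|extend_by0 s - extend_by0 t| <=
  b * ((size s)%:R + (size t)%:R - 2 * (size (common_prefix s t))%:R).
Proof.
move=> sN tN; have := g_embeds (exist _ s sN) (exist _ t tN).
by rewrite -!extend_by0E.
Qed.

Lemma extend_by0_fork s n t m t' : n <> m -> size t = size t' ->
  (size s + (size t).+1 <= N)%N ->
  2 * a * (size t).+1%:R <=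
  `|extend_by0 (s ++ n :: t) - extend_by0 (s ++ m :: t')|.
Proof.
move=> nm tt' stN.
have [||h _] := andP (@extend_by0_distance (s ++ n :: t) (s ++ m :: t') _ _).
- by rewrite size_cat.
- by rewrite size_cat /= -tt'.
apply: le_trans h; rewrite common_prefix_fork// !size_cat /= -tt' natrD.
by rewrite le_eqVlt; apply/orP; left; apply/eqP; ring.
Qed.

Lemma extend_by0_child s n : (size s < N)%N ->
  `|extend_by0 (s ++ [:: n]) - extend_by0 s| <= b.
Proof.
move=> sN.
have [||_ h] := andP (@extend_by0_distance (s ++ [:: n]) s _ _).
- by rewrite size_cat addn1.
- exact: ltnW.
apply: le_trans h _; rewrite common_prefix_cat size_cat /= natrD.
by rewrite le_eqVlt; apply/orP; left; apply/eqP; ring.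
Qed.

Lemma extend_by0_bounded s : 0 <= b -> `|extend_by0 s| <= `|extend_by0 [::]| + b * N%:R.
Proof.
move=> b0; have [sN|sN] := leqP (size s) N; last first.
  rewrite {1}/extend_by0 insubF/=; last by apply/negbTE; rewrite -ltnNge.
  by rewrite normr0 addr_ge0// mulr_ge0.
have [_ h] := andP (@extend_by0_distance s [::] sN (leq0n _)).
rewrite -[extend_by0 s](subrK (extend_by0 [::])) addrC.
apply: le_trans (ler_normD _ _) _; rewrite lerD2l; apply: le_trans h _.
have -> : common_prefix s [::] = [::] by case: (s).
by rewrite mulr0 subr0 addr0 ler_wpM2l// ler_nat.
Qed.

End Embedding.

Lemma expr_lt_eps (R : realType) (q x : R) : 0 <= q -> q < 1 -> 0 < x ->
  exists L : nat, q ^+ L < x.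
Proof.
move=> q0 q1 x0.
have /cvgr0_norm_lt/(_ _ x0)[L _ LP] : q ^+ n @[n --> \oo] --> (0 : R).
  by apply: cvg_expr; rewrite ger0_norm.
by exists L; have /= := LP L (leqnn L); rewrite ger0_norm// exprn_ge0.
Qed.

Theorem theorem1p1 (R : realType) (X : completeNormedModType R)
  (X_quasi_reflexive : quasi_reflexive X)
  (szlenk_X : eole (szlenk_index X) (Some omega))
  (szlenk_dual : eole (szlenk_index (dual X)) (Some omega)) :
  ~ equi_lipschitz_embeds
      (fun (N : {N : nat | (1 <= N)%N}) => @tree_dist R (val N))
      (fun x y : X => `|x - y|).
Proof.
move=> [g [a [b [a0 b0 g_emb]]]].
have [U [UU U_infty]] := ex_ultra_infty.
(* increments over [h] levels have norm at most [2 * b * h] and stay at distance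
   [a * h] from their limit; [eps] is half of the ratio, for strict inequalities *)
have eps0 : 0 < a / (4 * b) by rewrite divr_gt0// mulr_gt0.
have [C [delta [delta0 C_le1 C_half C_convex]]] :=
  ex_asymptotically_convex eps0 (szlenk_index_omega_finite szlenk_dual).
have [M sM] : exists n, szlenk_iter (delta / 8) (dual_ball X) (ord_nat n) = set0.
  by apply: szlenk_index_omega_finite => //; rewrite divr_gt0.
have M0 : (0 < M)%N.
  rewrite lt0n; apply/eqP => M0; move: sM; rewrite M0 => /seteqP[/(_ 0) + _].
  by apply; rewrite /dual_ball /= normr0.
have Mr0 : 0 < M%:R :> R by rewrite ltr0n.
have [theta [theta0 theta1 thetaM]] : exists theta : R,
    [/\ 0 < theta, theta <= 1 / 2 & theta * M%:R <= delta / 4].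
  exists (Num.min (1 / 2) (delta / 4 / M%:R)); split.
  - by rewrite lt_min !divr_gt0.
  - by rewrite ge_min lexx.
  - by rewrite -ler_pdivlMr// ge_min lexx orbT.
have [L L_small] : exists L : nat, (1 - theta) ^+ L < a / (2 * b).
  apply: expr_lt_eps; first by move: theta1; clear; lra.
    by move: theta0; clear; lra.
  by rewrite divr_gt0// mulr_gt0.
have ML0 k : (0 < M ^ k)%N by rewrite expn_gt0 M0.
pose N : {N : nat | (1 <= N)%N} := exist _ (M ^ L)%N (ML0 L).
have gN := g_emb N; pose f := extend_by0 (g N).
have fB := extend_by0_bounded gN ^~ (ltW b0).
have fF := extend_by0_fork gN.
have inc k : (k <= L)%N ->
    increments_le U f (M ^ L) C (M ^ k) (2 * b * (1 - theta) ^+ k * (M ^ k)%:R).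
  elim: k => [_ l lN|k IHk kL].
    have Ul := branch_ultra UU l.*2; have U2 := branch_ultra UU 2.
    apply: filterS (branch_size UU l.*2) => w wl.
    apply: filterS (branch_size UU 2) => -[|x [|y [|]]]//= _ phi /C_le1 phi1.
    apply: le_trans (ler_norm _) _; apply: le_trans (dual_apply_le _ phi1) _.
    rewrite mul1r expr0 !mulr1 /paired.
    rewrite (even_terms_cat _ wl) (odd_terms_cat _ wl) opprB.
    rewrite [X in _ + X]addrC addrACA (addrC (- _)).
    have -> : 2 * b = b + b by rewrite mulr_natl mulr2n.
    apply: le_trans (ler_normD _ _) _; apply: lerD.
      by apply: extend_by0_child gN _ _ _; rewrite (size_even_terms wl) -addn1.
    rewrite distrC.
    by apply: extend_by0_child gN _ _ _; rewrite (size_odd_terms wl) -addn1.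
  have q0 : 0 < 1 - theta by move: theta1; clear; lra.
  have r0 : 0 < 2 * b * (1 - theta) ^+ k * (M ^ k)%:R.
    by rewrite !mulr_gt0 ?exprn_gt0// ltr0n.
  rewrite expnS exprS natrM.
  have -> : 2 * b * ((1 - theta) * (1 - theta) ^+ k) * (M%:R * (M ^ k)%:R) =
      (1 - theta) * (M%:R * (2 * b * (1 - theta) ^+ k * (M ^ k)%:R)) by ring.
  apply: (increments_contract UU U_infty fB fF C_le1 C_half C_convex
    X_quasi_reflexive delta0 (ML0 k) r0 _ thetaM sM (IHk (ltnW kL))).
  have -> : a / (4 * b) * (2 * b * (1 - theta) ^+ k * (M ^ k)%:R) =
      a * (M ^ k)%:R * ((1 - theta) ^+ k / 2) by field; rewrite gt_eqF.
  rewrite gtr_pMr ?mulr_gt0 ?ltr0n// ltr_pdivrMr// mul1r.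
  apply: (@le_lt_trans _ _ 1); last by rewrite ltr1n.
  by apply: exprn_ile1; [exact: ltW|rewrite gerBl ltW].
have Uw := branch_ultra UU 0.*2; have Uv := branch_ultra UU (M ^ L).*2.
have := inc L (leqnn L) 0%N (leqnn _) => /principal_filterP incL.
have [v [v_le [[n [m [s [t [ev ov nm]]]]] sv]]] := filter_ex (filterI incL
  (filterI (branch_heads_neq UU U_infty (ML0 L)) (branch_size UU (M ^ L).*2))).
have := C_norm_le C_half v_le; rewrite cat0s /paired ev ov subrr subr0.
have ss : (size s).+1 = (M ^ L)%N by have := size_even_terms sv; rewrite ev.
have tt : (size t).+1 = (M ^ L)%N by have := size_odd_terms sv; rewrite ov.
have st : size s = size t by apply: succn_inj; rewrite ss tt.
have := fF [::] n s m t nm st; rewrite ss => /(_ (leqnn _)) /= h.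
move=> /(le_trans h); rewrite !mulrA ler_pM2r ?ltr0n// -!mulrA ler_pM2l//.
by move: L_small; rewrite ltr_pdivlMr ?mulr_gt0// [ltLHS]mulrC mulrA ltNge => /negP.
Qed.
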